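(* Let $(R, \mathfrak{m})$ be a complete discrete valuation ring with finite residue field $R/\mathfrak{m} = \mathbb{F}_q$, and let $P_1(t), \dots, P_r(t) \in R[t]$ be monic polynomials whose reductions modulo $\mathfrak{m}$ are distinct irreducible polynomials $\overline{P}_1(t), \dots, \overline{P}_r(t) \in \mathbb{F}_q[t]$. Suppose that $r \ge 1$ and $\deg(P_r) = 1$. Then for every $R$-module $H$ of finite length, $$\lim_{n \to \infty} \mathrm{Prob}_{A \in \mathrm{Mat}_n(R)}\left(\begin{array}{c} \mathrm{coker}(P_1(A)) = \cdots = \mathrm{coker}(P_{r-1}(A)) = 0 \\ \text{and } \mathrm{coker}(P_r(A)) \simeq H \end{array}\right) = \frac{1}{|\mathrm{Aut}_R(H)|} \prod_{j=1}^{r} \prod_{i=1}^{\infty} (1 - q^{-i \deg(P_j)}).$$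
   Context: $\mathrm{Mat}_n(R)$ is the set of $n \times n$ matrices over $R$. $\mathrm{Prob}_{A \in \mathrm{Mat}_n(R)}$ denotes probability with respect to the Haar measure of total mass $1$ on the compact additive group $\mathrm{Mat}_n(R)$. For a matrix $B \in \mathrm{Mat}_n(R)$, $\mathrm{coker}(B)$ is the cokernel of the $R$-linear map $B : R^n \to R^n$; isomorphisms $\simeq$ are of $R$-modules. $\mathrm{Aut}_R(H)$ is the group of $R$-module automorphisms of $H$. *)

(* Defs.v *)
From HB Require Import structures.
From mathcomp Require Import all_boot all_order all_algebra.
From mathcomp Require Import finmap.
From mathcomp Require Import all_classical all_reals all_analysis.

Set Implicit Arguments.
Unset Strict Implicit.
Unset Printing Implicit Defensive.

Import Order.TTheory GRing.Theory Num.Theory.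
Import numFieldNormedType.Exports.
Local Open Scope classical_set_scope.
Local Open Scope ring_scope.

Section CompleteDVR.
Variable R : idomainType.

Definition is_ideal (I : {pred R}) : Prop := submod_closed (I : {pred R^o}).

Definition principal_ideal (I : {pred R}) : Prop :=
  exists a : R, forall x, x \in I <-> exists b, x = b * a.

Definition maximal_ideal (I : {pred R}) : Prop :=
  [/\ is_ideal I, 1 \notin I &
      forall J : {pred R}, is_ideal J -> 1 \notin J ->
        {subset I <= J} -> {subset J <= I}].

(* Local principal ideal domain with maximal ideal [m], not a field. *)
Definition is_dvr (m : {pred R}) : Prop :=
  [/\ forall I : {pred R}, is_ideal I -> principal_ideal I,
      forall I : {pred R}, maximal_ideal I <-> I =i m &
      exists2 x : R, x \in m & x != 0].

(* The ideal power [m ^ k]: finite [R]-linear combinations of [k]-fold products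
   of elements of [m]; the coefficients [b] make [m ^ 0] the unit ideal. *)
Definition ideal_exp (m : {pred R}) (k : nat) : set R :=
  [set x | exists N (b : 'I_N -> R) (a : 'I_N -> 'I_k -> R),
     (forall i j, a i j \in m) /\ x = \sum_i b i * \prod_j a i j].

(* Existence of limits only: in a discrete valuation ring the m-adic topology is
   automatically Hausdorff. *)
Definition adic_complete (m : {pred R}) : Prop :=
  forall u : nat -> R,
    (forall k, exists N, forall i j, (N <= i)%N -> (N <= j)%N ->
       ideal_exp m k (u i - u j)) ->
    exists l : R, forall k, exists N, forall i, (N <= i)%N ->
      ideal_exp m k (u i - l).

Definition complete_dvr (m : {pred R}) : Prop := is_dvr m /\ adic_complete m.

Definition adic_mx (m : {pred R}) (n : nat) : Type := 'M[R]_n.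
HB.instance Definition _ m n := Choice.on (@adic_mx m n).
HB.instance Definition _ m n := isPointed.Build (@adic_mx m n) (0 : 'M[R]_n).

(* Open sets of the product topology on matrices, [R] being m-adic. *)
Definition mx_adic_open (m : {pred R}) (n : nat) : set (set (adic_mx m n)) :=
  [set U : set 'M[R]_n | forall A, U A -> exists k, forall B : 'M[R]_n,
     (forall i j, ideal_exp m k (B i j - A i j)) -> U B].

End CompleteDVR.

(* Matrices with the Borel sigma-algebra of that topology. *)
Notation borel_mx m n :=
  (g_sigma_algebraType (@mx_adic_open _ m n)).

(* As the total mass is 1, translation invariance determines the Haar measure;
   regularity is automatic on a compact metrizable group. *)
Definition haar_probability (K : realType) (R : idomainType) (m : {pred R})
    (n : nat) (mu : probability (borel_mx m n) K) : Prop :=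
  forall (A : 'M[R]_n) (E : set (borel_mx m n)), measurable E ->
    mu [set A + B | B in E] = mu E.

Section Cokernel.
Variables (R : comNzRingType) (n : nat) (B : 'M[R]_n).

Definition mx_image : {pred 'cV[R]_n} :=
  fun v => `[< exists w : 'cV[R]_n, v = B *m w >].

Lemma mx_image_submod : submod_closed mx_image.
Proof.
split; first by apply/asboolP; exists 0; rewrite mulmx0.
move=> a u v /asboolP[w ->] /asboolP[z ->]; apply/asboolP.
by exists (a *: w + z); rewrite mulmxDr scalemxAr.
Qed.
HB.instance Definition _ := GRing.isSubmodClosed.Build R 'cV[R]_n mx_image
  mx_image_submod.

Local Open Scope quotient_scope.

(* [{ideal_quot _}] only uses the additive group structure; the scalar
   multiplication is added below. *)
Definition coker := {ideal_quot mx_image}.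
HB.instance Definition _ := GRing.Zmodule.on coker.
HB.instance Definition _ := EqQuotient.on coker.

Definition coker_scale (a : R) (x : coker) : coker :=
  \pi_coker (a *: repr x).

Lemma coker_eqP (u v : 'cV[R]_n) :
  reflect (\pi_coker u = \pi_coker v) (u - v \in mx_image).
Proof. by rewrite Quotient.idealrBE; apply: eqP. Qed.

Lemma coker_pi_scale (a : R) (v : 'cV[R]_n) :
  coker_scale a (\pi_coker v) = \pi_coker (a *: v).
Proof.
apply/coker_eqP; rewrite -scalerBr rpredZ //.
by apply/coker_eqP; rewrite reprK.
Qed.

Lemma coker_piD (u v : 'cV[R]_n) :
  (\pi_coker u + \pi_coker v : coker) = \pi_coker (u + v).
Proof. exact: (esym (@Quotient.pi_add _ mx_image u v)). Qed.

Lemma coker_scaleA a b (x : coker) :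
  coker_scale a (coker_scale b x) = coker_scale (a * b) x.
Proof.
elim/quotW: x => v; rewrite (coker_pi_scale b) (coker_pi_scale a).
by rewrite (coker_pi_scale (a * b)) scalerA.
Qed.

Lemma coker_scale1 : left_id 1 coker_scale.
Proof. by elim/quotW=> v; rewrite coker_pi_scale scale1r. Qed.

Lemma coker_scaleDr : right_distributive coker_scale +%R.
Proof.
move=> a; elim/quotW=> u; elim/quotW=> v.
by rewrite coker_piD !coker_pi_scale coker_piD scalerDr.
Qed.

Lemma coker_scaleDl (x : coker) :
  {morph coker_scale^~ x : a b / a + b}.
Proof.
by move=> a b; elim/quotW: x => v; rewrite !coker_pi_scale coker_piD scalerDl.
Qed.

HB.instance Definition _ := GRing.Zmodule_isLmodule.Build R coker
  coker_scaleA coker_scale1 coker_scaleDr coker_scaleDl.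

End Cokernel.

Section Modules.
Variable R : nzRingType.

Definition lmod_isom (U V : lmodType R) : Prop :=
  exists f : {linear U -> V}, bijective f.

Definition zero_module (U : lmodType R) : Prop := forall x : U, x = 0.

(* Existence of a composition series. *)
Definition finite_length (H : lmodType R) : Prop :=
  exists (l : nat) (M : nat -> {pred H}),
    [/\ forall i, (i <= l)%N -> submod_closed (M i),
        forall x, (x \in M 0%N) = (x == 0),
        forall x, x \in M l &
        forall i, (i < l)%N ->
          [/\ {subset M i <= M i.+1},
              ~ {subset M i.+1 <= M i} &
              forall N : {pred H}, submod_closed N ->
                {subset M i <= N} -> {subset N <= M i.+1} ->
                N =i M i \/ N =i M i.+1]].

Definition Aut_mod (H : lmodType R) : set (H -> H) :=
  [set f | linear f /\ bijective f].

(* [fset_set] is the underlying finite set of a finite set, and empty otherwise;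
   [Aut_mod H] is finite when [H] has finite length over a ring with finite
   residue field. *)
Definition card_Aut (H : lmodType R) : nat := #|` fset_set (@Aut_mod H)|.

End Modules.

(* [\prod_(i >= 1) u i], the limit of the partial products. *)
Definition infprod (K : realType) (u : nat -> K) : K :=
  limn (fun N : nat => \prod_(1 <= i < N.+1) u i : K).

(* Main.v *)
From HB Require Import structures.
Require Import Defs.
From mathcomp Require Import all_boot all_order all_algebra.
From mathcomp Require Import finmap mxabelem ring lra zify.
From mathcomp Require Import all_classical all_reals all_analysis.

(* Write [P_r = t - a].  A surjection [R^n -> H] has kernel [M R^n] with
   [det M <> 0], and [A - a] has image [M R^n] iff [A = a + M B] with [B]
   invertible.  Every such kernel comes from [|Aut H|] surjections, almost all
   [n]-tuples of elements of [H] generate [H], and a coset of [M m Mat_n(R)] has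
   measure [1 / (|H|^n q^(n^2))].  It remains to show that, for a uniform matrix
   [B] over [F_q], the probability that [B] and all [P_j(a + M B)], [j < r], are
   invertible tends to the product of the Euler products, uniformly in the
   matrices [M] of bounded corank.

   For a fixed [A], Moebius inversion writes the indicator of the invertibility of
   [P_j(A)] as [\sum_s w_j(s) N_j(s)], where [N_j(s)] is the number
   of surjections of [F_q[t]]-modules from [(F_q^n, A)] onto [(F_q[t] / P_j)^s].
   Restricted to invertible [B], the expected number of surjections onto
   [\bigoplus_j (F_q[t] / P_j)^(s_j)] is at most 1 and tends to
   [\prod_i (1 - q^-i)], so dominated convergence applies, and
   [\sum_s w_j(s) = \prod_i (1 - q^(-i d_j))] by Euler's identity. *)

Set Implicit Arguments.
Unset Strict Implicit.
Unset Printing Implicit Defensive.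

Import Order.TTheory GRing.Theory Num.Theory.
Import numFieldNormedType.Exports.
Local Open Scope ring_scope.

(** As [deg P_r = 1], the condition on [P_r(A)] can be solved for [A], and the solution is affine in
    [B]. The obstacle is that [M] is singular modulo the maximal ideal unless [H = 0]: the residue
    of [A] is far from uniform, so counts of uniform matrices by conjugacy type do not apply to it.
    Surjections are counted instead because, for a fixed [Psi], the equation [Psi (a + M B) = C Psi]
    is linear in [B]. No [P_j] with [j < r] vanishes at [a] modulo the maximal ideal, so [C - a] is
    invertible and the equation prescribes [B] on the row space of [Psi M]. The number of invertible
    solutions is the same for all [Psi] such that [Psi M] has full rank, and few [Psi] violate this
    when the corank of [M] is bounded. Since [R^n / M R^n] is [H], that corank is bounded in terms
    of [|H|] alone, for all [n] and all kernels at once. The weights [w_j(s)] decay like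
    [Q^(-s(s+1)/2)] with [Q = q^(d_j)], fast enough to pay for the crude bound 1 on the moments. *)

Section CompanionField.
Variables (F : fieldType) (p : {poly F}).

(* The degree of [p] when [1 < size p], as a successor so that [horner_mx] applies
   to matrices of this size. *)
Definition qdim := (size p).-2.+1.

(** Rows are coordinates of [F['X] / p] in the monomial basis; [mulXmod] is the companion matrix of
    [p] acting on them from the right. *)
Definition mulXmod_fun (v : 'rV[F]_qdim) : 'rV[F]_qdim :=
  poly_rV ((rVpoly v * 'X) %% p).

Lemma mulXmod_fun_linear : linear mulXmod_fun.
Proof.
move=> a u v; rewrite /mulXmod_fun linearP mulrDl modpD -scalerAl modpZl.
by rewrite linearP.
Qed.
HB.instance Definition _ :=
  GRing.isLinear.Build F 'rV[F]_qdim 'rV[F]_qdim _ mulXmod_fun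
    mulXmod_fun_linear.

Definition mulXmod : 'M[F]_qdim := lin1_mx mulXmod_fun.

Hypothesis p_size : (1 < size p)%N.

Lemma qdimE : qdim.+1 = size p.
Proof. by rewrite /qdim; case: (size p) p_size => [|[|n]]. Qed.

Lemma size_rVpoly (v : 'rV[F]_qdim) : (size (rVpoly v) < size p)%N.
Proof. by rewrite -qdimE ltnS size_poly. Qed.

Lemma rVpoly_mod (v : 'rV[F]_qdim) : rVpoly v %% p = rVpoly v.
Proof. exact: modp_small (size_rVpoly v). Qed.

Lemma p_neq0 : p != 0.
Proof. by rewrite -size_poly_gt0 ltnW. Qed.

Lemma poly_rV_modK (f : {poly F}) : rVpoly (poly_rV (f %% p) : 'rV[F]_qdim) = f %% p.
Proof. by rewrite poly_rV_K // -ltnS qdimE ltn_modp p_neq0. Qed.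

Lemma mulXmod_horner (v : 'rV[F]_qdim) (f : {poly F}) :
  v *m horner_mx mulXmod f = poly_rV ((rVpoly v * f) %% p).
Proof.
elim/poly_ind: f => [|f c IHf].
  by rewrite rmorph0 mulmx0 mulr0 mod0p linear0.
rewrite rmorphD rmorphM /= horner_mx_X horner_mx_C mulmxDr mulmxA IHf.
rewrite mul_rV_lin1 /= /mulXmod_fun poly_rV_modK mul_mx_scalar.
rewrite mulrDr modpD linearD /=; congr (_ + _).
  by rewrite mulrC modp_mul mulrC mulrA.
by rewrite mulrC mul_polyC modpZl linearZ /= rVpoly_mod rVpolyK.
Qed.

Section Intertwine.
Variables (n : nat) (A : 'M[F]_n.+1).

Lemma intertwine_horner (X : 'M[F]_(qdim, n.+1)) (f : {poly F}) :
  X *m A = mulXmod *m X ->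
  X *m horner_mx A f = horner_mx mulXmod f *m X.
Proof.
move=> XA; elim/poly_ind: f => [|f c IHf]; first by rewrite !rmorph0 mulmx0 mul0mx.
rewrite !rmorphD !rmorphM /= !horner_mx_X !horner_mx_C mulmxDr mulmxDl.
by rewrite mulmxA IHf -!mulmxA XA scalar_mxC.
Qed.

(** The module [F['X] / p] is cyclic, so an intertwiner is determined by the image [x] of its
    generator 1 ([row1]), and every [x] killed by [p(A)] occurs. [krylov] rebuilds the intertwiner
    from [x]. *)
Definition krylov_fun (x : 'rV[F]_n.+1) (v : 'rV[F]_qdim) : 'rV[F]_n.+1 :=
  x *m horner_mx A (rVpoly v).

Lemma krylov_fun_linear x : linear (krylov_fun x).
Proof.
by move=> a u v; rewrite /krylov_fun linearP rmorphD /= horner_mxZ mulmxDr scalemxAr.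
Qed.
HB.instance Definition _ x :=
  GRing.isLinear.Build F 'rV[F]_qdim 'rV[F]_n.+1 _ (krylov_fun x)
    (krylov_fun_linear x).

Definition krylov (x : 'rV[F]_n.+1) : 'M[F]_(qdim, n.+1) := lin1_mx (krylov_fun x).

Definition row1 : 'rV[F]_qdim := poly_rV 1.

Lemma rVpoly_row1 : rVpoly row1 = 1.
Proof. by rewrite poly_rV_K // size_poly1. Qed.

Lemma mul_row1_krylov x : row1 *m krylov x = x.
Proof.
by rewrite mul_rV_lin1 /= /krylov_fun rVpoly_row1 rmorph1 mulmx1.
Qed.

Lemma krylov_row1 X : X *m A = mulXmod *m X -> krylov (row1 *m X) = X.
Proof.
move=> XA; apply/row_matrixP => i; rewrite !rowE mul_rV_lin1 /= /krylov_fun.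
rewrite -mulmxA intertwine_horner // mulmxA mulXmod_horner rVpoly_row1 mul1r.
by rewrite rVpoly_mod rVpolyK.
Qed.

Lemma krylov_intertwine x :
  x *m horner_mx A p = 0 -> krylov x *m A = mulXmod *m krylov x.
Proof.
move=> xp; apply/row_matrixP => i; rewrite !row_mul !rowE mul_rV_lin1 /=.
rewrite !mul_rV_lin1 /= /mulXmod_fun /krylov_fun poly_rV_modK.
set f := rVpoly _; rewrite [in RHS](_ : (f * 'X) %% p = f * 'X - p * (f * 'X %/ p)).
  rewrite rmorphB !rmorphM /= horner_mx_X mulmxBr !mulmxA.
  rewrite (_ : x *m horner_mx A p *m _ = 0) ?xp ?mul0mx //.
  by rewrite subr0.
by rewrite {2}(divp_eq (f * 'X) p) [p * _]mulrC addrAC subrr add0r.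
Qed.

Lemma intertwine_root X :
  X *m A = mulXmod *m X -> row1 *m X *m horner_mx A p = 0.
Proof.
move=> XA; rewrite -mulmxA intertwine_horner // mulmxA mulXmod_horner.
by rewrite modp_mull linear0 mul0mx.
Qed.

End Intertwine.

Hypothesis p_irr : irreducible_poly p.

(** Simplicity of [F['X] / p]: a Bezout inverse of [v] modulo [p] carries [v] to 1, and a further
    multiplication carries 1 to [w]. *)
Lemma mulXmod_transitive (v w : 'rV[F]_qdim) :
  v != 0 -> exists f, v *m horner_mx mulXmod f = w.
Proof.
move=> v0; have rv0 : rVpoly v != 0.
  by apply: contra_neq v0 => rv; rewrite -[v]rVpolyK rv linear0.
have : coprimep p (rVpoly v).
  rewrite irreducible_poly_coprime //; apply/negP => /dvdp_leq.
  by rewrite rv0 leqNgt size_rVpoly => /(_ isT).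
case/Bezout_eq1_coprimepP => -[u1 u2] /= u12.
exists (u2 * rVpoly w); rewrite mulXmod_horner mulrA [rVpoly v * u2]mulrC.
have -> : u2 * rVpoly v = 1 - u1 * p by rewrite -u12 addrC addKr.
rewrite mulrBl mul1r.
by rewrite modpD modpN -mulrA [p * _]mulrC mulrA modp_mull oppr0 addr0 rVpoly_mod rVpolyK.
Qed.

End CompanionField.

(** * Counting embeddings of semisimple modules *)

Section CountIntertwiners.
Variables (F : finFieldType).

Definition intertwiners (p : {poly F}) n (A : 'M[F]_n) : {set 'M[F]_(qdim p, n)} :=
  [set X | X *m A == mulXmod p *m X].

Lemma card_intertwiners (p : {poly F}) n (A : 'M[F]_n.+1) : (1 < size p)%N ->
  #|intertwiners p A| = #|[set x : 'rV[F]_n.+1 | x *m horner_mx A p == 0]|.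
Proof.
move=> p1; rewrite -(card_in_imset (f := mulmx (row1 p))).
  apply: eq_card => x; rewrite inE; apply/imsetP/eqP => [[X + ->]|xp].
    by rewrite inE => /eqP /(intertwine_root p1).
  exists (krylov p A x); first by rewrite inE; apply/eqP/krylov_intertwine.
  by rewrite mul_row1_krylov.
move=> X Y; rewrite !inE => /eqP XA /eqP YA XY.
by rewrite -(krylov_row1 p1 XA) XY (krylov_row1 p1 YA).
Qed.

Lemma card_intertwiners_block (p : {poly F}) n1 n2 (A1 : 'M[F]_n1) (A2 : 'M[F]_n2) :
  #|intertwiners p (block_mx A1 0 0 A2)| =
  (#|intertwiners p A1| * #|intertwiners p A2|)%N.
Proof.
rewrite -cardsX.
rewrite -(card_imset (f := fun X : 'M[F]_(qdim p, n1 + n2) => (lsubmx X, rsubmx X))).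
  apply: eq_card => -[X1 X2]; rewrite !inE /=; apply/imsetP/andP => [[X]|].
    rewrite inE => XA [-> ->]; move: XA; rewrite -{1 2}[X]hsubmxK mul_row_block.
    by rewrite !mulmx0 add0r addr0 mul_mx_row => /eqP/eq_row_mx[e1 e2]; rewrite e1 e2 !eqxx.
  case=> /eqP X1A /eqP X2A; exists (row_mx X1 X2); last by rewrite row_mxKl row_mxKr.
  by rewrite inE mul_row_block !mulmx0 add0r addr0 mul_mx_row X1A X2A.
by move=> X Y [] e1 e2; rewrite -[X]hsubmxK -[Y]hsubmxK e1 e2.
Qed.

Lemma card_intertwiners_unit (p : {poly F}) n (A : 'M[F]_n.+1) : (1 < size p)%N ->
  (horner_mx A p \in unitmx) = (#|intertwiners p A| == 1%N).
Proof.
move=> p1; rewrite card_intertwiners //.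
have z0 : 0 \in [set x : 'rV[F]_n.+1 | x *m horner_mx A p == 0].
  by rewrite inE mul0mx.
apply/idP/cards1P => [Au|[x xE]].
  exists 0; apply/setP => x; rewrite !inE; apply/eqP/eqP => [|->]; last exact: mul0mx.
  by move/(congr1 (mulmxr (invmx (horner_mx A p)))); rewrite /= mulmxK // mul0mx.
rewrite -row_free_unit; apply: inj_row_free => v vA.
have : v \in [set x : 'rV[F]_n.+1 | x *m horner_mx A p == 0] by rewrite inE vA.
by move: z0; rewrite xE !inE => /eqP -> /eqP.
Qed.

Section Extension.
Variables (p : {poly F}) (n D : nat) (A : 'M[F]_n.+1) (B : 'M[F]_D).
Variable Psi : 'M[F]_(D, n.+1).
Hypotheses (p_irr : irreducible_poly p) (Psi_free : row_free Psi).
Hypothesis PsiA : Psi *m A = B *m Psi.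

Lemma sub_horner (u : 'rV[F]_n.+1) f : (u <= Psi)%MS -> (u *m horner_mx A f <= Psi)%MS.
Proof.
move=> uP; elim/poly_ind: f => [|f c IHf]; first by rewrite rmorph0 mulmx0 sub0mx.
rewrite rmorphD rmorphM /= horner_mx_X horner_mx_C mulmxDr mul_mx_scalar mulmxA.
rewrite addmx_sub ?scalemx_sub //.
by apply: submx_trans (submxMr A IHf) _; rewrite PsiA submxMl.
Qed.

(** The row space of [Psi] is stable under [A]. A linear relation between the rows of [X] and those
    of [Psi] yields a nonzero element of [F['X] / p] that [X] sends into [Psi]; its multiples fill
    [F['X] / p] by simplicity, so all of [X] falls into [Psi]. *)
Lemma intertwiner_dichotomy X : X \in intertwiners p A ->
  row_free (col_mx X Psi) = ~~ (X <= Psi)%MS.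
Proof.
rewrite inE => /eqP XA; have [p1 _] := p_irr; apply/idP/idP.
  move=> Xf; apply/negP => /submxP[Z XZ].
  have : row_mx 1%:M (- Z) *m col_mx X Psi = 0.
    by rewrite mul_row_col mul1mx mulNmx XZ subrr.
  rewrite -[X in _ = X](mul0mx _ (col_mx X Psi)) => /(row_free_inj Xf).
  rewrite -row_mx0 => /eq_row_mx[/matrixP/(_ 0 0)]; rewrite !mxE eqxx => /eqP.
  by rewrite oner_eq0.
apply: contraNT => nf.
have [v v0 vX] : exists2 v : 'rV_(qdim p + D), v != 0 & v *m col_mx X Psi = 0.
  have /rowV0Pn[v] : kermx (col_mx X Psi) != 0.
    by rewrite kermx_eq0.
  by move=> /sub_kermxP vk v0; exists v.
have [a0|a0] := eqVneq (lsubmx v) 0.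
  have b0 : rsubmx v = 0.
    move: vX; rewrite -{1}[v]hsubmxK mul_row_col a0 mul0mx add0r.
    by rewrite -[X in _ = X](mul0mx _ Psi) => /(row_free_inj Psi_free).
  by case/negP: v0; rewrite -[v]hsubmxK a0 b0 row_mx0.
apply/row_subP => i; have [f fE] := mulXmod_transitive p1 p_irr (delta_mx 0 i) a0.
rewrite rowE -fE -mulmxA -(intertwine_horner f XA) mulmxA sub_horner //.
move: vX; rewrite -{1}[v]hsubmxK mul_row_col => /eqP; rewrite addr_eq0 => /eqP ->.
by rewrite -mulNmx submxMl.
Qed.

(** By the dichotomy, the intertwiners that do not extend [Psi] factor through it, and [Z *m Psi]
    makes them correspond to the intertwiners [Z] of [B]. *)
Lemma card_extension :
  (#|[set X in intertwiners p A | row_free (col_mx X Psi)]| + #|intertwiners p B|)%N =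
  #|intertwiners p A|.
Proof.
rewrite -[RHS](cardsID [set X | row_free (col_mx X Psi)]); congr addn.
  by apply: eq_card => X; rewrite !inE.
rewrite -(card_imset _ (row_free_inj Psi_free)); apply: eq_card => X; rewrite finset.in_setD.
apply/imsetP/andP => [[Z]|[+ XA]].
  rewrite inE => /eqP ZB XZ.
  have XA : X \in intertwiners p A.
    by rewrite inE XZ -mulmxA PsiA !mulmxA ZB.
  by split => //; rewrite inE intertwiner_dichotomy // XZ submxMl.
rewrite inE intertwiner_dichotomy // negbK => /submxP[Z XZ]; exists Z => //.
rewrite inE; apply/eqP/(row_free_inj Psi_free); move: XA; rewrite inE XZ => /eqP.
by rewrite -!mulmxA PsiA.
Qed.

End Extension.

Variables (J : finType) (p : J -> {poly F}).
Hypothesis p_irr : forall j, irreducible_poly (p j).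
Hypothesis p_coprime : forall i j, i != j -> coprimep (p i) (p j).

Let p_size j : (1 < size (p j))%N. Proof. by case: (p_irr j). Qed.
Let d j := qdim (p j).
Let q := #|F|.

(** A sequence encodes a direct sum of simple modules, with [count_mem j js] copies of the one
    attached to [j]. The recursion adds one simple summand at a time, which is the situation of
    [card_extension]. *)
Fixpoint blocks_dim (js : seq J) : nat :=
  if js is j :: js' then (d j + blocks_dim js')%N else 0%N.

Fixpoint blocks_mx (js : seq J) : 'M[F]_(blocks_dim js) :=
  if js is j :: js' then block_mx (mulXmod (p j)) 0 0 (blocks_mx js') else 0.

Lemma blocks_dimE js : blocks_dim js = (\sum_j count_mem j js * d j)%N.
Proof.
elim: js => [|i js IH] /=; first by rewrite big1.
rewrite IH (bigD1 i) //= [RHS](bigD1 i) //= eqxx mulnDl mul1n addnA; congr addn.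
by apply: eq_bigr => j; rewrite eq_sym => /negPf ->.
Qed.

(** Schur's lemma: the endomorphisms of [F['X] / p j] are the multiplications by its elements, and
    coprime moduli leave only the zero map. *)
Lemma card_intertwiners_mulXmod i j :
  #|intertwiners (p j) (mulXmod (p i))| = if i == j then (q ^ d j)%N else 1%N.
Proof.
rewrite card_intertwiners //; case: eqVneq => [<-|ij].
  rewrite -[d i]mul1n -card_mx -cardsT; apply: eq_card => x; rewrite !inE.
  by rewrite mulXmod_horner // modp_mull linear0 eqxx.
rewrite (_ : [set x | _] = [set 0]) ?cards1 //; apply/setP => x; rewrite !inE.
apply/eqP/eqP => [|->]; last exact: mul0mx.
rewrite mulXmod_horner // => /(congr1 rVpoly); rewrite linear0 poly_rV_modK //.
move/eqP; rewrite -/(_ %| _) Gauss_dvdpl ?p_coprime // => /modp_eq0P.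
by rewrite rVpoly_mod // => rx; rewrite -[x]rVpolyK rx linear0.
Qed.

Lemma card_intertwiners_blocks j js :
  #|intertwiners (p j) (blocks_mx js)| = (q ^ (d j * count_mem j js))%N.
Proof.
elim: js => [|i js IH] /=.
  rewrite muln0 expn0 (_ : intertwiners _ _ = [set: _]%SET) ?cardsT ?card_mx ?muln0 //.
  by apply/setP => X; rewrite !inE; apply/eqP; rewrite [LHS]thinmx0 [RHS]thinmx0.
rewrite card_intertwiners_block IH card_intertwiners_mulXmod.
by case: eqP => _; rewrite ?mul1n // add1n mulnS expnD.
Qed.

(* Dually, the [F['X]]-linear surjections from [(F^n, A)] onto the direct sum of
   the [F['X] / (p j)], [j] in [js]. *)
Definition free_intertwiners (js : seq J) n (A : 'M[F]_n) :
    {set 'M[F]_(blocks_dim js, n)} :=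
  [set Psi | row_free Psi && (Psi *m A == blocks_mx js *m Psi)].

Section FixedA.
Variables (n : nat) (A : 'M[F]_n.+1).

Lemma card_free_intertwiners_nil : #|free_intertwiners [::] A| = 1%N.
Proof.
rewrite (_ : free_intertwiners _ _ = [set: _]%SET) ?cardsT ?card_mx ?mul0n //.
apply/setP => X; rewrite !inE /row_free /=; apply/andP; split; apply/eqP.
  by rewrite [X]flatmx0 mxrank0.
by rewrite [LHS]flatmx0 [RHS]flatmx0.
Qed.

Lemma row_free_dsub m1 m2 (X : 'M[F]_(m1, n.+1)) (Y : 'M[F]_(m2, n.+1)) :
  row_free (col_mx X Y) -> row_free Y.
Proof.
move=> XYf; apply: inj_row_free => v vY.
have : row_mx 0 v *m col_mx X Y = 0 by rewrite mul_row_col mul0mx add0r vY.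
rewrite -[X in _ = X](mul0mx _ (col_mx X Y)) => /(row_free_inj XYf).
by rewrite -row_mx0 => /eq_row_mx[].
Qed.

Lemma free_intertwiners_cons j js X Psi :
  (col_mx X Psi \in free_intertwiners (j :: js) A) =
  [&& Psi \in free_intertwiners js A, X \in intertwiners (p j) A
    & row_free (col_mx X Psi)].
Proof.
rewrite !inE /= mul_col_mx mul_block_col !mul0mx addr0 add0r.
have -> : (col_mx (X *m A) (Psi *m A) == col_mx (mulXmod (p j) *m X) (blocks_mx js *m Psi))
    = (X *m A == mulXmod (p j) *m X) && (Psi *m A == blocks_mx js *m Psi).
  by apply/eqP/andP => [/eq_col_mx[-> ->]|[/eqP -> /eqP ->]].
have [/row_free_dsub -> /=|] := boolP (row_free _); first by rewrite andbT andbC.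
by rewrite /= !andbF.
Qed.

(** Forgetting the first block maps embeddings of the larger sum to embeddings [Psi] of the smaller
    one; the fibre over [Psi] has the size given by [card_extension], the same for every [Psi]. *)
Lemma card_free_intertwiners_cons j js :
  #|free_intertwiners (j :: js) A| =
  (#|free_intertwiners js A| *
   (#|intertwiners (p j) A| - q ^ (d j * count_mem j js)))%N.
Proof.
rewrite -[LHS]sum1_card.
rewrite (partition_big (fun Y : 'M[F]_(d j + blocks_dim js, n.+1) => dsubmx Y)
  (mem (free_intertwiners js A))) /=; last first.
  by move=> Y; rewrite -{1}[Y]vsubmxK free_intertwiners_cons => /and3P[].
rewrite -sum_nat_const; apply: eq_bigr => Psi PsiP.
have /andP[Psi_free /eqP PsiA] : row_free Psi && (Psi *m A == blocks_mx js *m Psi).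
  by move: PsiP; rewrite inE.
rewrite -(card_extension (p_irr j) Psi_free PsiA) card_intertwiners_blocks addnK.
rewrite -(card_imset _ (can_inj ((@col_mxKu _ _ _ _)^~ Psi))) -sum1_card.
apply: eq_bigl => Y; apply/andP/imsetP => [[YP /eqP YE]|[X]].
  exists (usubmx Y); last by rewrite -YE vsubmxK.
  rewrite inE -YE vsubmxK; move: YP; rewrite -{1}[Y]vsubmxK free_intertwiners_cons.
  by rewrite vsubmxK => /and3P[_ -> ->].
rewrite inE => /andP[XA Xf] ->; rewrite col_mxKd eqxx; split=> //.
by rewrite [_ \in _]free_intertwiners_cons PsiP XA Xf.
Qed.

(** The truncated subtraction of [card_free_intertwiners_cons] is thus exact as soon as one
    embedding exists. *)
Lemma card_intertwiners_ge j js : (0 < #|free_intertwiners js A|)%N ->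
  (q ^ (d j * count_mem j js) <= #|intertwiners (p j) A|)%N.
Proof.
case/card_gt0P => Psi; rewrite inE => /andP[Psi_free /eqP PsiA].
rewrite -(card_extension (p_irr j) Psi_free PsiA) card_intertwiners_blocks.
exact: leq_addl.
Qed.

(** Let [s] be the largest number of copies of [F['X] / p j] that embed together; the rank bounds it
    by [n.+1]. If the number of intertwiners exceeded the [q ^ (d j * s)] that factor through such
    an embedding, one more copy could be added. *)
Lemma card_intertwiners_pow j :
  exists2 s, (s <= n.+1)%N & #|intertwiners (p j) A| = (q ^ (d j * s))%N.
Proof.
have ex0 : exists s, (0 < #|free_intertwiners (nseq s j) A|)%N.
  by exists 0%N; rewrite card_free_intertwiners_nil.
have bnd s : (0 < #|free_intertwiners (nseq s j) A|)%N -> (s <= n.+1)%N.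
  case/card_gt0P => Psi; rewrite inE => /andP[/eqP Psi_free _].
  have := rank_leq_col Psi; rewrite Psi_free blocks_dimE; apply: leq_trans.
  rewrite (bigD1 j) //= count_nseq /= eqxx mul1n.
  by apply: leq_trans (leq_addr _ _); rewrite leq_pmulr.
case: (ex_maxnP ex0 bnd) => s s0 smax; exists s; first exact: bnd.
have := card_intertwiners_ge j s0; rewrite count_nseq /= eqxx mul1n => ge.
apply/eqP; rewrite eqn_leq ge andbT leqNgt; apply/negP => lt.
have /smax : (0 < #|free_intertwiners (nseq s.+1 j) A|)%N.
  rewrite card_free_intertwiners_cons muln_gt0 s0 subn_gt0 count_nseq /= eqxx mul1n.
  exact: lt.
by rewrite ltnn.
Qed.

Lemma card_free_intertwiners (R : comNzRingType) js :
  #|free_intertwiners js A|%:R =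
  \prod_j \prod_(i < count_mem j js)
     (#|intertwiners (p j) A|%:R - (q ^ d j)%:R ^+ i) :> R.
Proof.
elim: js => [|j js IH].
  by rewrite card_free_intertwiners_nil big1 // => j _; rewrite /= big_ord0.
have -> : #|free_intertwiners (j :: js) A|%:R = #|free_intertwiners js A|%:R *
    (#|intertwiners (p j) A|%:R - (q ^ d j)%:R ^+ count_mem j js) :> R.
  rewrite card_free_intertwiners_cons natrM.
  (* Without any embedding the subtraction may be truncated, but then both sides vanish. *)
  have [->|pos] := posnP #|free_intertwiners js A|; first by rewrite !mul0r.
  by rewrite natrB ?card_intertwiners_ge // expnM natrX.
rewrite IH (bigD1 j) //= [RHS](bigD1 j) //= eqxx add1n big_ord_recr /= mulrAC.
by congr (_ * _); apply: eq_bigr => i ij; rewrite eq_sym (negPf ij) add0n.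
Qed.

End FixedA.
End CountIntertwiners.

(** * Counting matrices over a finite field *)

Section MatrixCounts.
Variable F : finFieldType.
Let q := #|F|.

Lemma leq_card_bigcup (T I : finType) (P : pred I) (S : I -> {set T}) :
  (#|\bigcup_(i | P i) S i| <= \sum_(i | P i) #|S i|)%N.
Proof.
elim/big_rec2: _ => [|i m A _ le]; first by rewrite cards0.
by rewrite cardsU; apply: leq_trans (leq_subr _ _) _; rewrite leq_add2l.
Qed.

(** The rows of [X] are completed to a basis. The width is written [D + e] so that block matrices
    apply. *)
Lemma row_free_pid D e (X : 'M[F]_(D, D + e)) : row_free X ->
  exists2 V, V \in unitmx & X = row_mx 1%:M 0 *m V.
Proof.
move=> Xf; have rX : \rank X = D by apply/eqP.
exists (block_mx (col_ebase X) 0 0 1%:M *m row_ebase X).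
  rewrite unitmx_mul row_ebase_unit andbT unitmxE det_lblock det1 mulr1 -unitmxE.
  exact: col_ebase_unit.
rewrite mulmxA mul_row_block !mul1mx !mul0mx !addr0.
rewrite -{1}(mulmx_ebase X) rX; congr (_ *m _).
by rewrite pid_mx_row mul_mx_row mulmx0 mulmx1.
Qed.

Lemma card_mulmx_eq D n k (X : 'M[F]_(D, n)) (Y : 'M[F]_(D, k)) : row_free X ->
  #|[set B : 'M[F]_(n, k) | X *m B == Y]| = (q ^ ((n - D) * k))%N.
Proof.
move=> Xf; have [e nE] : exists e, n = (D + e)%N.
  by exists (n - D)%N; rewrite subnKC // -(eqP Xf) rank_leq_col.
subst n; case/row_free_pid: Xf => V Vu ->; rewrite addKn -card_mx.
have Vinj : injective (fun Z : 'M[F]_(e, k) => invmx V *m col_mx Y Z).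
  by move=> Z1 Z2 /(can_inj (mulKVmx Vu))/eq_col_mx[].
rewrite -cardsT -(card_imset _ Vinj); apply: eq_card => B; rewrite inE.
apply/eqP/imsetP => [|[Z _ ->]]; last first.
  by rewrite -mulmxA mulKVmx // mul_row_col mul1mx mul0mx addr0.
rewrite -mulmxA -{1}[V *m B]vsubmxK mul_row_col mul1mx mul0mx addr0 => VB.
by exists (dsubmx (V *m B)); rewrite // -VB vsubmxK mulKmx.
Qed.

(** Completing both [X] and [Y] to bases reduces to the case where each is [row_mx 1%:M 0]. The
    solutions are then the block lower triangular matrices with identity corner, invertible exactly
    when the block [W] is. *)
Lemma card_unitmx_mulmx_eq D e (X Y : 'M[F]_(D, D + e)) :
  row_free X -> row_free Y ->
  #|[set B : 'M[F]_(D + e) | (B \in unitmx) && (X *m B == Y)]| =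
  (q ^ (e * D) * #|[set W : 'M[F]_e | W \in unitmx]|)%N.
Proof.
move=> /row_free_pid[U Uu ->] /row_free_pid[V Vu ->].
rewrite -card_mx -cardsT -cardsX.
pose f (ZW : 'M[F]_(e, D) * 'M[F]_e) : 'M[F]_(D + e) :=
  invmx U *m block_mx 1%:M 0 ZW.1 ZW.2 *m V.
have f_inj : injective f.
  move=> [Z1 W1] [Z2 W2] /(can_inj (mulmxK Vu)).
  by move=> /(can_inj (mulKVmx Uu))/eq_block_mx[_ _ /= -> ->].
rewrite -(card_imset _ f_inj); apply: eq_card => B; rewrite inE.
apply/andP/imsetP => [[Bu /eqP XB]|[[Z W]]]; last first.
  rewrite !inE /= => Wu ->; rewrite /f !unitmx_mul unitmx_inv Uu Vu andbT /=.
  split; first by rewrite unitmxE det_lblock det1 mul1r -unitmxE.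
  rewrite -!mulmxA mulKVmx // !mulmxA mul_row_block !mul1mx !mul0mx !addr0.
  by rewrite eqxx.
pose B' := U *m B *m invmx V.
have BE : B = invmx U *m B' *m V by rewrite /B' -!mulmxA mulKmx // mulVmx // mulmx1.
have B'u : B' \in unitmx by rewrite !unitmx_mul Uu Bu unitmx_inv.
have uB' : usubmx B' = row_mx 1%:M 0.
  have : row_mx 1%:M 0 *m B' = row_mx 1%:M 0 :> 'M[F]_(D, D + e).
    by rewrite /B' !mulmxA XB mulmxK.
  by rewrite -{1}[B']vsubmxK mul_row_col mul1mx mul0mx addr0.
have B'E : B' = block_mx 1%:M 0 (dlsubmx B') (drsubmx B').
  by rewrite -[LHS]vsubmxK uB' -[dsubmx B']hsubmxK.
exists (dlsubmx B', drsubmx B'); last by rewrite /f /= -B'E.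
rewrite !inE /=; move: B'u; rewrite {1}B'E !unitmxE det_lblock det1 mul1r.
by [].
Qed.

(** Union bound: a failure means that [u *m Psi = y] for some [u != 0] and some [y] in the left
    kernel of [X], which has [q ^ (n - \rank X)] elements; each such equation holds for a proportion
    [q ^ - n] of the matrices [Psi]. *)
Lemma card_not_row_free_mul D n (X : 'M[F]_n) :
  (#|[set Psi : 'M[F]_(D, n) | ~~ row_free (Psi *m X)]| * q ^ n <=
   q ^ D * q ^ (D * n) * q ^ (n - \rank X))%N.
Proof.
pose S (u : 'rV[F]_D) (y : 'rV[F]_n) := [set Psi : 'M[F]_(D, n) | u *m Psi == y].
have sub : [set Psi : 'M[F]_(D, n) | ~~ row_free (Psi *m X)] \subset
    \bigcup_(u : 'rV[F]_D | u != 0) \bigcup_(y in rowg (kermx X)) S u y.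
  apply/fintype.subsetP => Psi; rewrite inE -kermx_eq0 => /rowV0Pn[u /sub_kermxP uPX u0].
  apply/finset.bigcupP; exists u => //.
  apply/finset.bigcupP; exists (u *m Psi); last by rewrite inE.
  by rewrite inE; apply/sub_kermxP; rewrite -mulmxA.
have cardS u y : u != 0 -> (#|S u y| * q ^ n = q ^ (D * n))%N.
  move=> u0; rewrite card_mulmx_eq; last first.
    apply: inj_row_free => v; rewrite [v]mx11_scalar mul_scalar_mx => /eqP.
    rewrite scaler_eq0 (negPf u0) orbF => /eqP ->.
    by apply/matrixP => i j; rewrite !mxE mul0rn.
  rewrite -expnD -mulSnr; congr (_ ^ (_ * _))%N.
  rewrite -addn1 subnK // lt0n; apply: contraNneq u0 => D0; apply/eqP/rowP => i.
  by have := ltn_ord i; rewrite {2}D0.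
pose N := (\sum_(u : 'rV[F]_D | u != 0%R) \sum_(y in rowg (kermx X)) #|S u y|)%N.
apply: (@leq_trans (N * q ^ n)%N).
  rewrite leq_mul2r; apply/orP; right; apply: leq_trans (subset_leq_card sub) _.
  apply: leq_trans (leq_card_bigcup _ _) _.
  by apply: leq_sum => u u0; apply: leq_card_bigcup.
rewrite /N big_distrl /=.
rewrite (eq_bigr (fun=> q ^ (n - \rank X) * q ^ (D * n)))%N; last first.
  move=> u u0; rewrite big_distrl /= (eq_bigr (fun=> q ^ (D * n)))%N; last first.
    by move=> y _; apply: cardS.
  by rewrite sum_nat_const card_rowg mxrank_ker.
rewrite sum_nat_const -[leqRHS]mulnA [(q ^ (D * n) * _)%N]mulnC leq_mul //.
by rewrite -[D in (q ^ D)%N]mul1n -card_mx max_card.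
Qed.

Lemma card_unitmx_real (K : numFieldType) e :
  #|[set W : 'M[F]_e | W \in unitmx]|%:R =
  q%:R ^+ (e * e) * \prod_(1 <= i < e.+1) (1 - q%:R ^- i) :> K.
Proof.
have q0 : q%:R != 0 :> K by rewrite pnatr_eq0 -lt0n; apply/card_gt0P; exists 0.
case: e => [|e].
  rewrite big_geq // mulr1 muln0 expr0 (_ : [set _ | _] = [set: _]%SET) ?cardsT ?card_mx //.
  by apply/setP => W; rewrite !inE unitmxE det_mx00 unitr1.
have -> : #|[set W : 'M[F]_e.+1 | W \in unitmx]| = #|('GL_e.+1[F])%g|.
  by rewrite cardsT /= card_sub cardsE.
rewrite card_GL // -/q natrM natr_prod.
have -> : (e.+1 * e.+1 = 'C(e.+1, 2) + \sum_(1 <= i < e.+2) i)%N.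
  elim: e.+1 => [|k IH]; first by rewrite big_geq.
  rewrite big_nat_recr //= binS bin1 addnACA -IH; lia.
rewrite exprD natrX -mulrA; congr (_ * _).
rewrite -prodrXr -big_split /=; apply: eq_big_nat => i /andP[i1 _].
rewrite natrB ?expn_gt0; last by rewrite lt0n -(pnatr_eq0 K) q0.
by rewrite natrX mulrBr mulr1 divff // expf_neq0.
Qed.

End MatrixCounts.

(** For [Q = #|F|], this is the density of invertible matrices of size [n], by
    [card_unitmx_real]. *)
Definition euler_prod {K : fieldType} (Q : K) (n : nat) : K :=
  \prod_(1 <= i < n.+1) (1 - Q ^- i).

Section PairCounts.
Variables (F : finFieldType) (J : finType) (p : J -> {poly F}) (a : F).
Hypothesis p_irr : forall j, irreducible_poly (p j).
Hypothesis p_a : forall j, coprimep (p j) ('X - a%:P).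
Let q := #|F|.

(** On each block, subtracting [a] gives the multiplication by ['X - a%:P] modulo [p j], a unit by
    coprimality. *)
Lemma blocks_sub_free js : row_free (blocks_mx p js - a%:M).
Proof.
elim: js => [|j js IH] /=; first by rewrite /row_free flatmx0 mxrank0.
have p1 : (1 < size (p j))%N by case: (p_irr j).
rewrite scalar_mx_block opp_block_mx add_block_mx !oppr0 !addr0.
move: IH; rewrite !row_free_unit !unitmxE det_lblock unitrM => ->; rewrite andbT.
rewrite -unitmxE -row_free_unit; apply: inj_row_free => v.
rewrite (_ : mulXmod (p j) - _ = horner_mx (mulXmod (p j)) ('X - a%:P)); last first.
  by rewrite rmorphB /= horner_mx_X horner_mx_C.
rewrite mulXmod_horner // => /(congr1 rVpoly); rewrite linear0 poly_rV_modK //.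
move/eqP; rewrite -/(_ %| _) Gauss_dvdpl ?p_a // => /modp_eq0P.
by rewrite rVpoly_mod // => rx; rewrite -[v]rVpolyK rx linear0.
Qed.

Section FixedX.
Variables (n : nat) (X : 'M[F]_n) (js : seq J).
Let D := blocks_dim p js.

(** These pairs are counted in two ways: along [Psi] here, where the count is explicit, and along
    [B] in [card_unit_intertwiner_pairs_fst], where it is the sum of the moments. *)
Definition unit_intertwiner_pairs : {set 'M[F]_n * 'M[F]_(D, n)} :=
  [set BP | (BP.1 \in unitmx) &&
            (BP.2 \in free_intertwiners p js (a%:M + X *m BP.1))].

(* [Psi (a + X B) = C Psi] iff [(Psi X) B = (C - a) Psi], where [C - a] is
   invertible because no [p j] vanishes at [a]. *)
Lemma free_intertwiner_fiber (Psi : 'M[F]_(D, n)) :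
  [set B : 'M[F]_n | (B \in unitmx) && (Psi \in free_intertwiners p js (a%:M + X *m B))] =
  if row_free (Psi *m X)
  then [set B | (B \in unitmx) && ((Psi *m X) *m B == (blocks_mx p js - a%:M) *m Psi)]
  else finset.set0.
Proof.
have eqE B : (Psi *m (a%:M + X *m B) == blocks_mx p js *m Psi) =
             ((Psi *m X) *m B == (blocks_mx p js - a%:M) *m Psi).
  by rewrite mulmxDr mulmxBl (scalar_mxC a Psi) mulmxA [RHS]eq_sym subr_eq eq_sym addrC.
have mulf m1 m2 m3 (U : 'M[F]_(m1, m2)) (V : 'M[F]_(m2, m3)) :
    row_free (U *m V) -> row_free U.
  rewrite -!row_leq_rank => le; apply: leq_trans le _; exact: mxrankM_maxl.
apply/setP => B; rewrite !inE eqE; have [PXf|PXf] := boolP (row_free (Psi *m X)).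
  by rewrite inE (mulf _ _ _ _ _ PXf).
(* The right-hand side of the equation has full row rank since [Psi] has, and this forces full row
   rank on [Psi *m X]. *)
rewrite inE; apply/negP => /and3P[Bu Pf /eqP eqB]; case/negP: PXf.
apply: (mulf _ _ _ _ B); rewrite eqB.
by rewrite /row_free mxrankMfree // -/(row_free _) blocks_sub_free.
Qed.

Lemma card_unit_intertwiner_pairsE :
  #|unit_intertwiner_pairs| =
  (\sum_(Psi | row_free (Psi *m X)) #|[set B : 'M[F]_n | (B \in unitmx) &&
     ((Psi *m X) *m B == (blocks_mx p js - a%:M) *m Psi)]|)%N.
Proof.
rewrite -sum1_card (partition_big snd predT) //= [RHS]big_mkcond /=.
apply: eq_bigr => Psi _.
have -> : (if row_free (Psi *m X)
  then #|[set B | (B \in unitmx) && (Psi *m X *m B == (blocks_mx p js - a%:M) *m Psi)]|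
  else 0%N) = #|[set B : 'M[F]_n | (B \in unitmx) &&
     (Psi \in free_intertwiners p js (a%:M + X *m B))]|.
  by rewrite free_intertwiner_fiber; case: ifP; rewrite ?cards0.
have pinj : injective (fun B : 'M[F]_n => (B, Psi)) by move=> B1 B2 [].
rewrite -(card_imset _ pinj) -sum1_card; apply: eq_bigl => -[B P] /=.
apply/andP/imsetP => [[BP /eqP PE]|[B' + [-> ->]]]; last by rewrite !inE eqxx.
by exists B; rewrite ?PE //; move: BP; rewrite !inE /= PE.
Qed.

(** Without the invertibility of [B], each of the at most [q ^ (D * n)] matrices [Psi] has
    [q ^ ((n - D) * n)] solutions. So the moment is at most 1, whatever [X] and [D] are. *)
Lemma unit_intertwiner_pairs_le : (#|unit_intertwiner_pairs| <= q ^ (n * n))%N.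
Proof.
rewrite card_unit_intertwiner_pairsE.
(* For [D > n], no matrix [Psi *m X] is row free and the sum is empty. *)
have [/eqP Dn|Dn] := boolP ((D - n)%N == 0%N); last first.
  rewrite big1 // => Psi /eqP rP; case/negP: Dn; rewrite subn_eq0.
  by rewrite -[D]rP rank_leq_col.
apply: (@leq_trans (\sum_(Psi : 'M[F]_(D, n)) q ^ ((n - D) * n))%N).
  rewrite big_mkcond; apply: leq_sum => Psi _; case: ifP => // Pf.
  rewrite -(card_mulmx_eq ((blocks_mx p js - a%:M) *m Psi) Pf).
  by apply: subset_leq_card; apply/fintype.subsetP => B; rewrite !inE => /andP[].
rewrite sum_nat_const card_mx -expnD -mulnDl subnKC //.
by rewrite -subn_eq0 Dn.
Qed.

Lemma card_unit_intertwiner_pairs (Dn : (D <= n)%N) :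
  #|unit_intertwiner_pairs| =
  (#|[set Psi : 'M[F]_(D, n) | row_free (Psi *m X)]| *
   (q ^ ((n - D) * D) * #|[set W : 'M[F]_(n - D) | W \in unitmx]|))%N.
Proof.
rewrite card_unit_intertwiner_pairsE -sum_nat_const [LHS]big_mkcond [RHS]big_mkcond /=.
apply: eq_bigr => Psi _; rewrite inE; case: ifP => // Pf.
have Pf' : row_free Psi.
  rewrite -row_leq_rank; apply: leq_trans (mxrankM_maxl _ X).
  by rewrite row_leq_rank.
have Cf : row_free ((blocks_mx p js - a%:M) *m Psi).
  by rewrite /row_free mxrankMfree // -/(row_free _) blocks_sub_free.
move: (Psi *m X) Pf (_ *m Psi) Cf => U Uf V Vf.
have [e nE] : exists e, n = (D + e)%N by exists (n - D)%N; rewrite subnKC.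
by subst n; rewrite card_unitmx_mulmx_eq // addKn.
Qed.

(** The moment is exactly [euler_prod q (n - D)] times the proportion of [Psi] with [Psi *m X] row
    free. The hypothesis says that [q ^ (n - \rank X)] is at most [h], so the union bound loses at
    most [h * q ^ D / q ^ n]. *)
Lemma unit_intertwiner_pairs_bounds (K : realFieldType) (h : nat) :
  (D <= n)%N -> (q ^ n <= h * q ^ \rank X)%N ->
  euler_prod (q%:R : K) (n - D) * (1 - h%:R * q%:R ^+ D / q%:R ^+ n) <=
  #|unit_intertwiner_pairs|%:R / q%:R ^+ (n * n) <= euler_prod (q%:R : K) (n - D).
Proof.
move=> Dn rX; set G := euler_prod _ _; set m := #|_|%:R / _.
have q0 : 0 < q%:R :> K by rewrite ltr0n; apply/card_gt0P; exists 0.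
have qn0 : q%:R != 0 :> K by rewrite gt_eqF.
have G0 : 0 <= G.
  rewrite /G /euler_prod; apply: prodr_ge0 => i _; rewrite subr_ge0 invf_le1 ?exprn_gt0 //.
  by rewrite exprn_ege1 // ler1n -(ltr0n K).
pose f : K := #|[set Psi : 'M[F]_(D, n) | row_free (Psi *m X)]|%:R / q%:R ^+ (D * n).
have -> : m = G * f.
  rewrite /m /f card_unit_intertwiner_pairs // !natrM card_unitmx_real -/(euler_prod _ _) -/G.
  rewrite natrX.
  have -> : (n * n = (n - D) * D + (n - D) * (n - D) + D * n)%N.
    by rewrite -mulnDr subnKC // -mulnDl subnK.
  rewrite !exprD; field.
  by rewrite !expf_neq0.
have fE : f = 1 - #|[set Psi : 'M[F]_(D, n) | ~~ row_free (Psi *m X)]|%:R / q%:R ^+ (D * n).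
  rewrite /f; apply/eqP; rewrite eq_sym subr_eq -mulrDl -natrD.
  rewrite (_ : (_ + _)%N = q ^ (D * n))%N ?natrX ?divff ?expf_neq0 //.
  rewrite -[RHS](card_mx F D n) -(cardsC [set Psi : 'M[F]_(D, n) | row_free (Psi *m X)]).
  by congr (_ + _)%N; apply: eq_card => Psi; rewrite !inE.
apply/andP; split; last first.
  rewrite -[leRHS]mulr1 ler_wpM2l // fE.
  by rewrite gerBl divr_ge0 // exprn_ge0 // ltW.
rewrite ler_wpM2l // fE lerD2l lerN2 ler_pdivlMr ?exprn_gt0 // mulrAC ler_pdivrMr ?exprn_gt0 //.
rewrite -!natrX -!natrM ler_nat.
have := card_not_row_free_mul D X; rewrite -/q => le1.
rewrite -(leq_pmul2r (m := q ^ \rank X)) ?expn_gt0 -?(ltr0n K) ?q0 //.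
apply: leq_trans (leq_mul le1 (leqnn _)) _.
rewrite -[leqLHS]mulnA -(expnD q (n - _)) subnK ?rank_leq_col //.
have -> : (h * q ^ D * q ^ (D * n) * q ^ \rank X =
  q ^ D * q ^ (D * n) * (h * q ^ \rank X))%N by rewrite -!mulnA mulnCA (mulnCA h).
by rewrite leq_mul.
Qed.

End FixedX.
End PairCounts.

(** * Gauss sums and Euler products *)

Section EulerSum.
Variables (K : realFieldType) (Q : K).
Hypothesis Q2 : 2 <= Q.

Let Q1 : 1 < Q. Proof. by apply: lt_le_trans Q2; rewrite ltr1n. Qed.
Let Q0 : 0 < Q. Proof. exact: lt_trans Q1. Qed.
Let Qn0 n : 0 < Q ^+ n. Proof. exact: exprn_gt0. Qed.

Lemma exprn_sub1_ge1 i : 1 <= Q ^+ i.+1 - 1.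
Proof.
rewrite lerBrDr exprS; apply: le_trans Q2 _.
by rewrite ler_pMr // exprn_ege1 // ltW.
Qed.

Let QB_neq0 i : Q ^+ i.+1 - 1 != 0.
Proof. by rewrite gt_eqF // (lt_le_trans _ (exprn_sub1_ge1 i)). Qed.

(* For [V] a vector space over a field of [Q] elements,
   [\sum_s inv_weight s * #(injections from a space of dimension s into V)]
   is 1 if [V = 0] and 0 otherwise. *)
Definition inv_weight (s : nat) : K :=
  (-1) ^+ s / \prod_(1 <= i < s.+1) (Q ^+ i - 1).

Lemma inv_weight0 : inv_weight 0 = 1.
Proof. by rewrite /inv_weight big_geq // divr1. Qed.

Lemma inv_weightS s : inv_weight s.+1 = - inv_weight s / (Q ^+ s.+1 - 1).
Proof.
by rewrite /inv_weight big_nat_recr //= exprS mulN1r invfM !mulNr mulrA.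
Qed.

(** This is [(-1)^s Q^(s(s-1)/2)] times the Gaussian binomial coefficient of [n] and [s]; the
    recurrence [gauss_term_recl] is the q-Pascal rule. *)
Definition gauss_term n s : K := inv_weight s * \prod_(i < s) (Q ^+ n - Q ^+ i).

Lemma gauss_term0 n : gauss_term n 0 = 1.
Proof. by rewrite /gauss_term big_ord0 mulr1 inv_weight0. Qed.

Lemma gauss_term_recl n s :
  gauss_term n.+1 s.+1 = Q ^+ s.+1 * gauss_term n s.+1 - Q ^+ s * gauss_term n s.
Proof.
rewrite /gauss_term big_ord_recl expr0 [in RHS]big_ord_recr /=.
have -> : \prod_(i < s) (Q ^+ n.+1 - Q ^+ bump 0 i) =
    Q ^+ s * \prod_(i < s) (Q ^+ n - Q ^+ i).
  have <- : \prod_(i < s) Q = Q ^+ s by rewrite prodr_const card_ord.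
  rewrite -big_split /=; apply: eq_bigr => i _.
  by rewrite /bump /= add1n !exprS mulrBr.
rewrite inv_weightS; set P := \prod_(i < s) _; have := QB_neq0 s; rewrite !exprS.
by move: (Q ^+ s) (Q ^+ n) (inv_weight s) P => x y z P xn; field.
Qed.

Lemma gauss_term_gt n s : (n < s)%N -> gauss_term n s = 0.
Proof.
move=> ns; rewrite /gauss_term (bigD1 (Ordinal ns)) //= subrr mul0r mulr0.
by [].
Qed.

(** The q-binomial theorem, by the q-Pascal rule and the substitution of [Q * x] for [x]. It serves
    twice: [x = 1] gives the Moebius inversion, where the factor [i = 0] vanishes unless [n = 0],
    and [x = Q ^- n] gives the total weight. *)
Lemma gauss_sum n N x : (n < N)%N ->
  \sum_(s < N) gauss_term n s * x ^+ s = \prod_(i < n) (1 - Q ^+ i * x).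
Proof.
elim: n N x => [|n IHn] [//|N] x nN.
  rewrite big_ord0 big_ord_recl gauss_term0 expr0 mulr1.
  rewrite big1 ?addr0 // => i _; rewrite gauss_term_gt ?mul0r //.
rewrite [LHS]big_ord_recl [RHS]big_ord_recl /= gauss_term0 expr0 !mul1r.
rewrite [X in _ = _ * X](eq_bigr (fun i : 'I_n => 1 - Q ^+ i * (Q * x))); last first.
  by move=> i _; rewrite /bump /= add1n exprSr -mulrA.
rewrite -(IHn N.+1 (Q * x)) ?(ltnW nN) // mulrBl mul1r.
rewrite [X in X - _]big_ord_recl /= -addrA; congr (_ + _).
  by rewrite gauss_term0 !expr0 mulr1.
have -> : \sum_(s < N.+1) gauss_term n s * (Q * x) ^+ s =
          \sum_(s < N) gauss_term n s * (Q * x) ^+ s.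
  by rewrite big_ord_recr /= gauss_term_gt ?mul0r ?addr0.
rewrite mulr_sumr -sumrB; apply: eq_bigr => i _.
rewrite /bump /= add1n gauss_term_recl !exprMn !exprS; ring.
Qed.

Lemma inv_weight_normS s : `|inv_weight s.+1| = `|inv_weight s| / (Q ^+ s.+1 - 1).
Proof.
rewrite inv_weightS normrM normrN normfV [X in _ / X]ger0_norm //.
exact: le_trans (exprn_sub1_ge1 s).
Qed.

Lemma inv_weight_le s : `|inv_weight s| <= 2 / 2 ^+ s.
Proof.
case: s => [|s]; first by rewrite inv_weight0 normr1 expr0 divr1 ler1n.
elim: s => [|s IHs].
  rewrite inv_weight_normS inv_weight0 normr1 !expr1 divff ?pnatr_eq0 // mul1r.
  by have q2 := Q2; rewrite invf_le1; lra.
rewrite inv_weight_normS [2 ^+ _]exprS invfM mulrA mulrAC.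
apply: ler_pM => //.
  by rewrite invr_ge0 (le_trans _ (exprn_sub1_ge1 _)).
rewrite lef_pV2 ?posrE ?(lt_le_trans _ (exprn_sub1_ge1 _)) //.
rewrite !exprS lerBrDr; have := exprn_ege1 s (ltW Q1) => Qs.
have : 2 * 2 * 1 <= Q * (Q * Q ^+ s).
  by rewrite [leRHS]mulrA; apply: ler_pM; rewrite ?mulr_ge0 //; apply: ler_pM.
lra.
Qed.

(** The extra factor [Q ^+ s] absorbs the truncation error [Q ^+ s / Q ^+ n] in
    [sum_inv_weight_euler] and the growth [2 ^+ s] in [prod_sum_norm_le]. The constant is
    [8 / 2 ^+ s.+1 = (2 / 2 ^+ s) * 2], the last 2 bounding [Q ^+ s.+1 / (Q ^+ s.+1 - 1)]. *)
Lemma inv_weight_expr_le s : `|inv_weight s| * Q ^+ s <= 8 / 2 ^+ s.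
Proof.
case: s => [|s]; first by rewrite inv_weight0 normr1 !expr0 divr1 mulr1 ler1n.
rewrite inv_weight_normS mulrAC -mulrA.
have -> : 8 / 2 ^+ s.+1 = 2 / 2 ^+ s * 2 :> K.
  by rewrite exprS; field; rewrite expf_neq0 ?pnatr_eq0.
apply: ler_pM; rewrite ?inv_weight_le //.
  by rewrite divr_ge0 ?(ltW (Qn0 _)) // (le_trans _ (exprn_sub1_ge1 _)).
rewrite ler_pdivrMr ?(lt_le_trans _ (exprn_sub1_ge1 _)) //.
by have := exprn_sub1_ge1 s; lra.
Qed.

Lemma sum_half_le N (c : K) : 0 <= c -> \sum_(s < N) c / 2 ^+ s <= 2 * c.
Proof.
move=> c0; suff -> : \sum_(s < N) c / 2 ^+ s = 2 * c - 2 * c / 2 ^+ N.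
  by rewrite gerBl !mulr_ge0 // invr_ge0 exprn_ge0.
elim: N => [|N IHN]; first by rewrite big_ord0 expr0 divr1 subrr.
rewrite big_ord_recr /= IHN exprS.
by field; rewrite expf_neq0 ?pnatr_eq0.
Qed.

(** The product is at least 1 minus the sum of the [Q ^+ i / Q ^+ n], and the powers [Q ^+ i] with
    [i < s] add up to at most [Q ^+ s], because [2 * Q ^+ s <= Q ^+ s.+1]. *)
Lemma prod_sub_bounds n s : (s <= n)%N ->
  1 - Q ^+ s / Q ^+ n <= \prod_(i < s) (1 - Q ^+ i / Q ^+ n) <= 1.
Proof.
elim: s => [|s IHs] sn; first by rewrite big_ord0 lexx gerBl divr_ge0 // ltW.
have /andP[le1 le2] := IHs (ltnW sn); rewrite big_ord_recr /=.
have x0 : 0 <= Q ^+ s / Q ^+ n by rewrite divr_ge0 // ltW.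
have x1 : Q ^+ s / Q ^+ n <= 1.
  by rewrite ler_pdivrMr // mul1r ler_weXn2l ?(ltW Q1) // ltnW.
have QE : 2 * (Q ^+ s / Q ^+ n) <= Q ^+ s.+1 / Q ^+ n.
  by rewrite exprS -mulrA ler_wpM2r.
move: (Q ^+ s.+1 / Q ^+ n) (Q ^+ s / Q ^+ n) (\prod_(i < s) _) x0 x1 QE le1 le2.
by move=> z x y *; apply/andP; split; nra.
Qed.

Lemma gauss_term_div n s :
  gauss_term n s * (Q ^- n) ^+ s = inv_weight s * \prod_(i < s) (1 - Q ^+ i / Q ^+ n).
Proof.
rewrite /gauss_term -mulrA; congr (_ * _).
have <- : \prod_(i < s) Q ^- n = (Q ^- n) ^+ s by rewrite prodr_const card_ord.
rewrite -big_split /=; apply: eq_bigr => i _.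
  by rewrite mulrBl divff ?gt_eqF.
Qed.

Lemma euler_prodE n : \prod_(i < n) (1 - Q ^+ i / Q ^+ n) = euler_prod Q n.
Proof.
rewrite /euler_prod big_add1 /= big_mkord (reindex_inj rev_ord_inj) /=.
apply: eq_bigr => i _; congr (1 - _).
have -> : Q ^+ n = Q ^+ (n - i.+1) * Q ^+ i.+1 by rewrite -exprD subnK.
by rewrite invfM mulrA divff ?mul1r // gt_eqF.
Qed.

(** The q-binomial theorem at [Q ^- n] writes [euler_prod Q n] as the same sum of weights, each
    multiplied by a factor within [Q ^+ s / Q ^+ n] of 1. The constant 16 bounds the sum of the
    [8 / 2 ^+ s]. *)
Lemma sum_inv_weight_euler n :
  `|\sum_(s < n.+1) inv_weight s - euler_prod Q n| <= 16 / Q ^+ n.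
Proof.
have := gauss_sum (Q ^- n) (ltnSn n); rewrite euler_prodE => <-.
rewrite -sumrB; apply: le_trans (ler_norm_sum _ _ _) _.
apply: (@le_trans _ _ (\sum_(s < n.+1) 8 / 2 ^+ s / Q ^+ n)).
  apply: ler_sum => s _; rewrite gauss_term_div -{1}[inv_weight s]mulr1 -mulrBr.
  rewrite normrM; have sn : (s <= n)%N by rewrite -ltnS.
  have /andP[le1 le2] := prod_sub_bounds sn.
  rewrite [X in _ * X]ger0_norm ?subr_ge0 //.
  apply: (@le_trans _ _ (`|inv_weight s| * (Q ^+ s / Q ^+ n))).
    by rewrite ler_wpM2l //; lra.
  by rewrite mulrA ler_wpM2r ?invr_ge0 ?(ltW (Qn0 n)) ?inv_weight_expr_le.
rewrite -mulr_suml ler_wpM2r ?invr_ge0 ?(ltW (Qn0 n)) //.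
have -> : 16 = 2 * 8 :> K by ring.
exact: sum_half_le.
Qed.

Lemma euler_prod_ge0 n : 0 <= euler_prod Q n.
Proof.
apply: prodr_ge0 => i _; rewrite subr_ge0 invf_le1 //.
by rewrite exprn_ege1 // ltW.
Qed.

Lemma euler_prod_noninc m n : (m <= n)%N -> euler_prod Q n <= euler_prod Q m.
Proof.
elim: n => [|n IHn]; first by rewrite leqn0 => /eqP ->.
rewrite leq_eqVlt => /predU1P[-> //|]; rewrite ltnS => /IHn; apply: le_trans.
rewrite /euler_prod big_nat_recr //= ler_piMr ?gerBl ?invr_ge0 ?(ltW (Qn0 _)) //.
exact: euler_prod_ge0.
Qed.

Lemma euler_prod_le1 n : euler_prod Q n <= 1.
Proof. by apply: le_trans (euler_prod_noninc (leq0n n)) _; rewrite /euler_prod big_geq. Qed.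

End EulerSum.

(** * Moebius inversion and domination of the moments *)

Section GoodMatrices.
Variables (F : finFieldType) (J : finType) (p : J -> {poly F}) (a : F).
Hypothesis p_irr : forall j, irreducible_poly (p j).
Hypothesis p_coprime : forall i j, i != j -> coprimep (p i) (p j).
Hypothesis p_a : forall j, coprimep (p j) ('X - a%:P).
Variable K : realFieldType.
Let q := #|F|.
Let d j := qdim (p j).
Let Q j : K := (q ^ d j)%:R.

Lemma card_field_ge2 : (2 <= q)%N.
Proof.
by rewrite /q (cardD1 0) (cardD1 1) !inE oner_eq0.
Qed.

Lemma Q_ge2 j : 2 <= Q j.
Proof.
rewrite /Q ler_nat; apply: leq_trans card_field_ge2 _; rewrite -{1}[q]expn1.
by rewrite leq_pexp2l // ltnW // card_field_ge2.
Qed.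

Definition mult_seq (N : nat) (f : {ffun J -> 'I_N}) : seq J :=
  flatten [seq nseq (f j) j | j <- enum J].

Lemma count_mult_seq N (f : {ffun J -> 'I_N}) j : count_mem j (mult_seq f) = f j.
Proof.
rewrite /mult_seq count_flatten -map_comp sumnE big_map big_enum /= (bigD1 j) //=.
rewrite count_nseq /= eqxx mul1n big1 ?addn0 // => i ij.
by rewrite count_nseq /= (negPf ij).
Qed.

(** For each [j] the number of intertwiners is [Q j ^+ s] with [s <= n.+1], so a sum over ['I_n.+2]
    is complete; its value is 1 for [s = 0] and 0 otherwise. Expanding the product over [j] yields
    embeddings of direct sums. *)
Lemma sum_gauss_unit n (A : 'M[F]_n.+1) :
  ([forall j, horner_mx A (p j) \in unitmx])%:R =
  \sum_(f : {ffun J -> 'I_n.+2}) (\prod_j inv_weight (Q j) (f j)) *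
     #|free_intertwiners p (mult_seq f) A|%:R :> K.
Proof.
transitivity (\prod_j \sum_(s < n.+2) inv_weight (Q j) s *
    \prod_(i < s) (#|intertwiners (p j) A|%:R - Q j ^+ i)).
  have fct j : \sum_(s < n.+2) inv_weight (Q j) s *
      \prod_(i < s) (#|intertwiners (p j) A|%:R - Q j ^+ i) =
      (horner_mx A (p j) \in unitmx)%:R.
    have p1 : (1 < size (p j))%N by case: (p_irr j).
    rewrite card_intertwiners_unit //.
    have [s sn ->] := card_intertwiners_pow p_irr p_coprime A j.
    have := gauss_sum (Q_ge2 j) 1 (sn : (s < n.+2)%N).
    under eq_bigr do rewrite expr1n mulr1.
    rewrite /gauss_term -natrX -expnM => ->.
    case: s sn => [|s] sn; first by rewrite big_ord0 muln0 expn0 eqxx.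
    rewrite big_ord_recl expr0 mulr1 subrr mul0r gtn_eqF //.
    apply: leq_trans card_field_ge2 _; rewrite -{1}[q]expn1.
    by rewrite leq_pexp2l // ltnW // card_field_ge2.
  rewrite (eq_bigr _ (fun j _ => fct j)).
  case: (boolP [forall j, _]) => [/forallP all_u|].
    by rewrite big1 // => j _; rewrite all_u.
  by rewrite negb_forall => /existsP[j /negPf ju]; rewrite (bigD1 j) //= ju mul0r.
rewrite bigA_distr_bigA /=; apply: eq_bigr => f _.
rewrite card_free_intertwiners // -big_split /=; apply: eq_bigr => j _.
by rewrite count_mult_seq.
Qed.

Definition good_matrices n (X : 'M[F]_n.+1) : {set 'M[F]_n.+1} :=
  [set B | (B \in unitmx) && [forall j, horner_mx (a%:M + X *m B) (p j) \in unitmx]].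

Lemma card_unit_intertwiner_pairs_fst n (X : 'M[F]_n) js :
  #|unit_intertwiner_pairs p a X js| =
  (\sum_(B : 'M[F]_n | B \in unitmx) #|free_intertwiners p js (a%:M + X *m B)|)%N.
Proof.
rewrite -sum1_card (partition_big fst (mem unitmx)) /=; last first.
  by move=> BP; rewrite inE => /andP[].
apply: eq_bigr => B Bu.
have pinj : injective (fun Psi : 'M[F]_(blocks_dim p js, n) => (B, Psi)).
  by move=> P1 P2 [].
rewrite -(card_imset _ pinj) -sum1_card; apply: eq_bigl => -[B' P] /=.
apply/andP/imsetP => [[BP /eqP BE]|[P' Pf [-> ->]]]; last first.
  by split=> //; rewrite inE; apply/andP; split.
by exists P; rewrite ?BE //; move: BP; rewrite inE /= BE => /andP[].
Qed.

Lemma card_good_matrices n (X : 'M[F]_n.+1) :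
  #|good_matrices X|%:R =
  \sum_(f : {ffun J -> 'I_n.+2}) (\prod_j inv_weight (Q j) (f j)) *
     #|unit_intertwiner_pairs p a X (mult_seq f)|%:R :> K.
Proof.
transitivity (\sum_(B : 'M[F]_n.+1 | B \in unitmx)
    ([forall j, horner_mx (a%:M + X *m B) (p j) \in unitmx])%:R : K).
  rewrite -sum1_card natr_sum big_mkcond [RHS]big_mkcond /=.
  by apply: eq_bigr => B _; rewrite inE; case: (B \in unitmx) => //=; case: ifP.
under eq_bigr do rewrite sum_gauss_unit.
rewrite exchange_big /=; apply: eq_bigr => f _.
by rewrite -mulr_sumr card_unit_intertwiner_pairs_fst natr_sum.
Qed.

Definition dim_bound : nat := (\sum_j d j)%N.

Lemma blocks_dim_mult_seq N (f : {ffun J -> 'I_N}) :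
  (blocks_dim p (mult_seq f) <= (\sum_j f j) * dim_bound)%N.
Proof.
rewrite blocks_dimE big_distrl /=; apply: leq_sum => j _.
by rewrite count_mult_seq leq_mul2l /dim_bound (bigD1 j) //= leq_addr orbT.
Qed.

(** The dominating series. The weights remain summable after multiplication by [2 ^+ (\sum_j f j)],
    which pays for the large [f]; each [j] contributes at most [16 = 2 * 8]. *)
Lemma prod_sum_norm_le n :
  \sum_(f : {ffun J -> 'I_n}) `|\prod_j inv_weight (Q j) (f j)| * 2 ^+ (\sum_j f j) <=
  16 ^+ #|J|.
Proof.
under eq_bigr do rewrite normr_prod -prodrXr -big_split /=.
rewrite -(bigA_distr_bigA (fun j (s : 'I_n) => `|inv_weight (Q j) s| * 2 ^+ s)) /=.
rewrite -prodr_const; apply: ler_prod => j _; apply/andP; split.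
  by apply: sumr_ge0 => s _; rewrite mulr_ge0 ?exprn_ge0.
apply: (@le_trans _ _ (\sum_(s < n) 8 / 2 ^+ s)); last first.
  by apply: le_trans (sum_half_le _ _) _ => //; lra.
apply: ler_sum => s _; apply: le_trans (inv_weight_expr_le (Q_ge2 j) s).
by rewrite ler_wpM2l // lerXn2r ?nnegrE ?(le_trans _ (Q_ge2 j)) // Q_ge2.
Qed.

(** The cutoff [S] on the total multiplicity keeps the dimension below [S * dim_bound]. The three
    errors come from the tail of the Euler product, from the corank of [X], and from the
    multiplicities beyond the cutoff. *)
Lemma card_good_matrices_approx n (X : 'M[F]_n.+1) (h S : nat) (L : K) :
  0 <= L -> (forall e, L <= euler_prod q%:R e) ->
  (q ^ n.+1 <= h * q ^ \rank X)%N -> (S * dim_bound <= n.+1)%N ->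
  `|#|good_matrices X|%:R / q%:R ^+ (n.+1 * n.+1) -
    L * \prod_j \sum_(s < n.+2) inv_weight (Q j) s| <=
  16 ^+ #|J| * (euler_prod q%:R (n.+1 - S * dim_bound) - L +
     h%:R * q%:R ^+ (S * dim_bound) / q%:R ^+ n.+1 + (2 ^+ S)^-1).
Proof.
move=> L0 LG rX Sn; set T := (S * dim_bound)%N.
have q2 : 2 <= q%:R :> K by rewrite ler_nat card_field_ge2.
have q0 : 0 < q%:R :> K by apply: lt_le_trans q2.
pose m (f : {ffun J -> 'I_n.+2}) : K :=
  #|unit_intertwiner_pairs p a X (mult_seq f)|%:R / q%:R ^+ (n.+1 * n.+1).
set delta := euler_prod _ _ - L + _.
have hq0 k : 0 <= h%:R * q%:R ^+ k / q%:R ^+ n.+1 :> K.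
  by rewrite divr_ge0 ?mulr_ge0 ?exprn_ge0 // ltW.
have delta0 : 0 <= delta by rewrite addr_ge0 ?subr_ge0.
have L1 : L <= 1 by apply: le_trans (LG 0%N) _; apply: euler_prod_le1.
have m_approx f : `|m f - L| <= (delta + (2 ^+ S)^-1) * 2 ^+ (\sum_j f j).
  (* If [\sum_j f j <= S] then the dimension is bounded and [m f] is close to [L];
     otherwise the trivial bound 1 is at most [2 ^ (\sum_j f j) / 2 ^ S]. *)
  have [fS|fS] := leqP (\sum_j f j) S.
    apply: (@le_trans _ _ delta); last first.
      rewrite -[leLHS]mulr1; apply: ler_pM => //; first by rewrite lerDl invr_ge0 exprn_ge0.
      by rewrite exprn_ege1 // ler1n.
    have DT : (blocks_dim p (mult_seq f) <= T)%N.
      by apply: leq_trans (blocks_dim_mult_seq f) _; rewrite leq_mul2r fS orbT.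
    have /andP[] := unit_intertwiner_pairs_bounds p_irr p_a K (leq_trans DT Sn) rX.
    rewrite -/(m f); set D := blocks_dim p _ in DT *.
    have GT : euler_prod q%:R (n.+1 - D) <= euler_prod q%:R (n.+1 - T) :> K.
      exact/euler_prod_noninc/leq_sub2l.
    have G1 : euler_prod q%:R (n.+1 - D) <= 1 :> K by apply: euler_prod_le1.
    have GL := LG (n.+1 - D)%N.
    have hT : h%:R * q%:R ^+ D / q%:R ^+ n.+1 <= h%:R * q%:R ^+ T / q%:R ^+ n.+1 :> K.
      rewrite ler_wpM2r ?invr_ge0 ?exprn_ge0 ?(ltW q0) // ler_wpM2l //.
      by rewrite ler_weXn2l // (le_trans _ q2) // ler1n.
    have := hq0 D; rewrite /delta.
    move: (h%:R * _ / _) (h%:R * _ / _) hT => x y xy x0 le1 le2.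
    by rewrite ler_norml; apply/andP; split; nra.
  apply: (@le_trans _ _ 1).
    have m1 : m f <= 1.
      rewrite /m ler_pdivrMr ?exprn_gt0 // mul1r -natrX ler_nat.
      exact: unit_intertwiner_pairs_le.
    have m0 : 0 <= m f by rewrite divr_ge0 // exprn_ge0 // ltW.
    by rewrite ler_norml; apply/andP; split; lra.
  apply: (@le_trans _ _ ((2 ^+ S)^-1 * 2 ^+ (\sum_j f j))).
    by rewrite mulrC ler_pdivlMr ?exprn_gt0 // mul1r ler_weXn2l ?ler1n // ltnW.
  by rewrite ler_wpM2r ?exprn_ge0 // lerDr.
rewrite card_good_matrices bigA_distr_bigA /= mulr_suml mulr_sumr -sumrB.
apply: le_trans (ler_norm_sum _ _ _) _.
apply: (@le_trans _ _ (\sum_(f : {ffun J -> 'I_n.+2})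
    `|\prod_j inv_weight (Q j) (f j)| * 2 ^+ (\sum_j f j) * (delta + (2 ^+ S)^-1))).
  apply: ler_sum => f _; rewrite -[X in `|X - _|]mulrA -/(m f) [L * _]mulrC -mulrBr.
  by rewrite normrM -[leRHS]mulrA ler_wpM2l // [leRHS]mulrC.
rewrite -mulr_suml ler_wpM2r ?prod_sum_norm_le //.
by rewrite addr_ge0 // invr_ge0 exprn_ge0.
Qed.

End GoodMatrices.

(** * Infinite Euler products and the uniform limit *)

Section EulerLimit.
Variables (K : realType).
Local Open Scope classical_set_scope.
Local Open Scope ring_scope.

Definition euler_lim (Q : K) : K := limn (euler_prod Q).

Lemma cvg_euler_prod (Q : K) : 2 <= Q -> euler_prod Q @ \oo --> euler_lim Q.
Proof.
move=> Q2; apply: nonincreasing_is_cvgn.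
  by move=> m n mn; apply: euler_prod_noninc.
by exists 0 => _ [n _ <-]; apply: euler_prod_ge0.
Qed.

Lemma euler_lim_le (Q : K) n : 2 <= Q -> euler_lim Q <= euler_prod Q n.
Proof.
move=> Q2; apply: nonincreasing_cvgn_ge; last exact: cvg_euler_prod.
by move=> k m km; apply: euler_prod_noninc.
Qed.

Lemma euler_lim_ge0 (Q : K) : 2 <= Q -> 0 <= euler_lim Q.
Proof.
move=> Q2; apply: limr_ge; first exact: cvg_euler_prod.
by apply: nearW => n; apply: euler_prod_ge0.
Qed.

Lemma infprod_euler_lim (q : K) (d : nat) :
  infprod (fun i => 1 - q ^- (i * d)) = euler_lim (q ^+ d).
Proof.
rewrite /infprod /euler_lim; congr (limn _); apply/funext => n.
by apply: eq_bigr => i _; rewrite -exprM mulnC.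
Qed.

Lemma cvg_inv_expr (Q : K) : 2 <= Q -> (Q ^- n) @[n --> \oo] --> (0 : K).
Proof.
move=> Q2; have Q0 : 0 < Q by apply: lt_le_trans Q2.
rewrite (_ : (fun n => _) = GRing.exp Q^-1); last by apply/funext => n; rewrite exprVn.
apply: cvg_expr; rewrite ger0_norm ?invr_ge0 ?(ltW Q0) //.
by rewrite invf_lt1 // (lt_le_trans _ Q2) // ltr1n.
Qed.

Lemma cvg_sum_inv_weight (Q : K) : 2 <= Q ->
  (\sum_(s < n.+1) inv_weight Q s) @[n --> \oo] --> euler_lim Q.
Proof.
move=> Q2.
have d0 : (\sum_(s < n.+1) inv_weight Q s - euler_prod Q n) @[n --> \oo] --> (0 : K).
  apply/norm_cvg0P.
  apply: (@squeeze_cvgr _ _ _ _ (fun=> 0) (fun n => 16 * Q ^- n)).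
  - by apply: nearW => n; rewrite normr_ge0 sum_inv_weight_euler.
  - exact: cvg_cst.
  - rewrite -[X in _ --> X](mulr0 16); apply: cvgMr; exact: cvg_inv_expr.
rewrite -[euler_lim Q]add0r.
rewrite (_ : (fun n => _) = (fun n => (\sum_(s < n.+1) inv_weight Q s - euler_prod Q n) +
   euler_prod Q n)); last by apply/funext => n; rewrite subrK.
by apply: cvgD => //; apply: cvg_euler_prod.
Qed.

End EulerLimit.

Section GoodMatricesLimit.
Local Open Scope classical_set_scope.
Local Open Scope ring_scope.
Variables (K : realType) (F : finFieldType) (J : finType) (p : J -> {poly F}) (a : F).
Hypothesis p_irr : forall j, irreducible_poly (p j).
Hypothesis p_coprime : forall i j, i != j -> coprimep (p i) (p j).
Hypothesis p_a : forall j, coprimep (p j) ('X - a%:P).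
Let q := #|F|.

(** The first factor is the Euler product of the linear polynomial [P_r]; here it is the common
    limit of all the moments. *)
Definition good_limit : K :=
  euler_lim (q%:R : K) * \prod_j euler_lim ((q ^ qdim (p j))%:R : K).

Lemma good_matrices_limit (h : nat) (eps : K) : 0 < eps ->
  exists n0, forall n, (n0 <= n)%N -> forall X : 'M[F]_n.+1,
    (q ^ n.+1 <= h * q ^ \rank X)%N ->
    `|#|good_matrices p a X|%:R / q%:R ^+ (n.+1 * n.+1) - good_limit| < eps.
Proof.
move=> eps0; have q2 : 2 <= q%:R :> K by rewrite ler_nat card_field_ge2.
have Q2 j : 2 <= (q ^ qdim (p j))%:R :> K by apply: Q_ge2.
set L := euler_lim (q%:R : K).
pose C : K := 16 ^+ #|J|; have C0 : 0 < C by apply: exprn_gt0.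
(* Three errors below [e], multiplied by [C], use up three quarters of [eps]; the last quarter is
   for the truncated sums of weights. *)
pose e := eps / (4 * C); have e0 : 0 < e by rewrite divr_gt0 // mulr_gt0.
have half0 : (2 : K) ^- S @[S --> \oo] --> (0 : K) by apply: cvg_inv_expr.
have [S S_e] : exists S, (2 : K) ^- S < e.
  move/cvgrPdist_lt: half0 => /(_ e e0)[S _ /(_ S (leqnn S)) S_e]; exists S.
  by move: S_e; rewrite /= sub0r normrN ger0_norm // invr_ge0 exprn_ge0.
set T := (S * dim_bound p)%N.
have cvgG : euler_prod (q%:R : K) (n.+1 - T) @[n --> \oo] --> L.
  rewrite (cvg_shiftS (fun n => euler_prod (q%:R : K) (n - T))).
  by apply: (cvg_comp _ (euler_prod (q%:R : K)) (@cvg_subnr T)); apply: cvg_euler_prod.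
have cvgh : h%:R * q%:R ^+ T / q%:R ^+ n.+1 @[n --> \oo] --> (0 : K).
  rewrite -[X in _ --> X](mulr0 (h%:R * q%:R ^+ T)); apply: cvgMr.
  by rewrite (cvg_shiftS (fun n => q%:R ^- n : K)); apply: cvg_inv_expr.
have cvgV : L * \prod_j \sum_(s < n.+2) inv_weight ((q ^ qdim (p j))%:R : K) s
    @[n --> \oo] --> good_limit.
  apply: cvgMr.
  apply: (@cvg_big K J *%R 1 xpredT (@mul_continuous K) nat \oo (index_enum J)
    (fun j n => \sum_(s < n.+2) inv_weight ((q ^ qdim (p j))%:R : K) s)
    (fun j => euler_lim ((q ^ qdim (p j))%:R : K))) => j _.
  rewrite (cvg_shiftS (fun n => \sum_(s < n.+1) inv_weight ((q ^ qdim (p j))%:R : K) s)).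
  exact: cvg_sum_inv_weight.
have near_n : \forall n \near \oo, [/\ (T <= n.+1)%N,
    `|L - euler_prod (q%:R : K) (n.+1 - T)| < e,
    `|0 - h%:R * q%:R ^+ T / q%:R ^+ n.+1 : K| < e &
    `|good_limit - L * \prod_j \sum_(s < n.+2) inv_weight ((q ^ qdim (p j))%:R : K) s|
      < eps / 4].
  near=> n; split.
  - by rewrite leqW //; near: n; exists T.
  - by near: n; move/cvgrPdist_lt : cvgG => /(_ e e0).
  - by near: n; move/cvgrPdist_lt : cvgh => /(_ e e0).
  - by near: n; move/cvgrPdist_lt : cvgV => /(_ (eps / 4)); apply; rewrite divr_gt0.
have [n0 _ Hn0] := near_n; exists n0 => n n0n X rX.
have [Tn G_e h_e V_e] := Hn0 n n0n.
have := @card_good_matrices_approx _ _ p a p_irr p_coprime p_a K n X h S L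
  (euler_lim_ge0 q2) (fun e => euler_lim_le e q2) rX Tn.
have {}G_e : euler_prod (q%:R : K) (n.+1 - T) - L < e.
  by apply: le_lt_trans G_e; rewrite distrC ler_norm.
have {}h_e : h%:R * q%:R ^+ T / q%:R ^+ n.+1 < e :> K.
  by apply: le_lt_trans h_e; rewrite sub0r normrN ler_norm.
rewrite -/T -/C -/q; set pr := #|_|%:R / _; set V := L * _ in V_e *.
set G := euler_prod _ _ in G_e *; set hh := _ / _ in h_e *.
move=> le1.
have {le1} le2 : `|pr - V| < C * (e * 3).
  by apply: le_lt_trans le1 _; rewrite ltr_pM2l //; lra.
have Ce : C * (e * 3) = eps * 3 / 4 by rewrite /e; field; rewrite gt_eqF.
have -> : pr - good_limit = (pr - V) - (good_limit - V) by ring.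
apply: le_lt_trans (ler_normB _ _) _; lra.
Unshelve. all: by end_near. Qed.

End GoodMatricesLimit.

(** * Discrete valuation rings and modules of finite length *)

Section DiscreteValuationRing.
Variables (R : idomainType) (m : {pred R}).
Hypothesis m_dvr : is_dvr m.
Local Open Scope classical_set_scope.
Local Open Scope ring_scope.

Lemma dvr_maximal : maximal_ideal m.
Proof. by case: m_dvr => _ /(_ m)[_ h] _; apply: h. Qed.

Lemma dvr_uniformizer :
  exists2 pi : R, pi != 0 & forall x, x \in m <-> exists b, x = b * pi.
Proof.
have [m_ideal _ _] := dvr_maximal.
case: m_dvr => /(_ _ m_ideal)[pi piE] _ [x xm x0]; exists pi => //.
by apply: contraNneq x0 => pi0; have /piE[b ->] := xm; rewrite pi0 mulr0.
Qed.

(* By Zorn's lemma, a non-unit lies in a maximal ideal, that is, in [m]. *)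
Lemma dvr_unit (x : R) : x \notin m -> x \is a GRing.unit.
Proof.
move=> xm; apply/negP => x_nu.
pose I0 : set R := [set y | exists b, y = b * x].
pose proper_ideal (A : set R) :=
  (forall b u v, A u -> A v -> A (b * u + v)) /\ ~ A 1.
have I0_proper : proper_ideal I0.
  split=> [b u v [b1 ->] [b2 ->]|[b b1]].
    by exists (b * b1 + b2); rewrite mulrDl mulrA.
  by case: x_nu; apply/unitrP; exists b; rewrite [x * b]mulrC -b1.
(* The sets [A] considered are those whose union with [I0] is a proper ideal; adding [I0] takes care
   of the empty chain. *)
have [] := @Zorn_bigcup R [set A | proper_ideal (I0 `|` A)].
  move=> C C_prop C_tot /=; split; last first.
    case=> [|[A CA A1]]; first by case: I0_proper.
    by case: (C_prop A CA) => _; apply; right.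
  move=> b u v.
  have in_one A w : C A -> (I0 `|` A) w -> (I0 `|` \bigcup_(X in C) X) w.
    by move=> CA [Iw|Aw]; [left|right; exists A].
  move=> [Iu|[A CA Au]] [Iv|[B CB Bv]].
  - by left; apply: I0_proper.1.
  - by apply: (in_one B) => //; apply: (C_prop B CB).1; [left|right].
  - by apply: (in_one A) => //; apply: (C_prop A CA).1; [right|left].
  - have [AB|BA] := C_tot A B CA CB.
      by apply: (in_one B) => //; apply: (C_prop B CB).1; right => //; apply: AB.
    by apply: (in_one A) => //; apply: (C_prop A CA).1; right => //; apply: BA.
move=> A [A_prop A_max].
pose I : {pred R} := fun y => `[< (I0 `|` A) y >].
have I_max : maximal_ideal I.
  split.
  - split; first by apply/asboolP; left; exists 0; rewrite mul0r.
    move=> b u v /asboolP Iu /asboolP Iv; apply/asboolP; exact: A_prop.1.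
  - by apply/asboolP; exact: A_prop.2.
  - move=> J [_ J_lin] J1 IJ y yJ; apply/asboolP; right; apply: contrapT => Ay.
    apply: (A_max [set z | z \in J]).
      split; last by move=> JA; apply: Ay; apply: JA.
      by move=> z Az; apply: IJ; apply/asboolP; right.
    rewrite /= setUidr; last by move=> z Iz; apply: IJ; apply/asboolP; left.
    by split=> [b u v|]; [exact: J_lin|exact/negP].
case: m_dvr => _ /(_ I)[/(_ I_max) Im _] _; move/negP: xm; apply; rewrite -Im.
by apply/asboolP; left; exists 1; rewrite mul1r.
Qed.

Variables (F : finFieldType) (red : {rmorphism R -> F}).
Hypothesis red_surj : forall y : F, exists x : R, red x = y.
Hypothesis red_ker : forall x : R, (x \in m) = (red x == 0).

Lemma dvr_unitE (x : R) : (x \is a GRing.unit) = (red x != 0).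
Proof.
apply/idP/idP => [xu|rx]; last by apply: dvr_unit; rewrite red_ker.
by rewrite -unitfE rmorph_unit.
Qed.

Lemma dvr_unitmx n (A : 'M[R]_n) : (A \in unitmx) = (map_mx red A \in unitmx).
Proof. by rewrite !unitmxE dvr_unitE det_map_mx unitfE. Qed.

Lemma residue_lift : exists lift : F -> R, cancel lift red.
Proof. by have [lift liftK] := choice red_surj; exists lift. Qed.

Variable pi : R.
Hypothesis piE : forall x, x \in m <-> exists b, x = b * pi.

Lemma red_uniformizer : red pi = 0.
Proof.
apply/eqP; rewrite -red_ker; apply/piE; exists 1; by rewrite mul1r.
Qed.

Lemma map_mx_red0 n k (A : 'M[R]_(n, k)) :
  map_mx red A = 0 <-> exists C, A = pi *: C.
Proof.
split=> [A0|[C ->]]; last first.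
  by apply/matrixP => i j; rewrite !mxE rmorphM red_uniformizer mul0r.
have ex ij : exists b, A ij.1 ij.2 = b * pi.
  by apply/piE; rewrite red_ker; move/matrixP: A0 => /(_ ij.1 ij.2); rewrite !mxE => ->.
have [C CE] := choice ex; exists (\matrix_(i, j) C (i, j)).
by apply/matrixP => i j; rewrite !mxE mulrC -CE.
Qed.

Lemma ideal_exp_uniformizer k x : ideal_exp m k x -> exists b, x = b * pi ^+ k.
Proof.
case=> N [b [a [am ->]]].
elim/big_rec: _ => [|i y _ [c ->]]; first by exists 0; rewrite mul0r.
have [e ->] : exists e, \prod_j a i j = e * pi ^+ k.
  have -> : pi ^+ k = \prod_(j < k) pi by rewrite prodr_const card_ord.
  elim/big_rec2: _ => [|j y1 y2 _ [e ->]]; first by exists 1; rewrite mul1r.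
  by have /piE[u ->] := am i j; exists (u * e); rewrite mulrACA.
by exists (b i * e + c); rewrite mulrDl mulrA.
Qed.

Section FiniteLength.
Variable H : lmodType R.

(** The quotient [N / M] is simple, hence generated by any [x] outside [M]. It is killed by [pi]:
    otherwise [pi *: x] would generate it too, and [(1 - b * pi) *: x] would lie in [M] for some
    [b], although [1 - b * pi] is a unit. *)
Lemma composition_step (M N : {pred H}) :
  submod_closed M -> submod_closed N -> {subset M <= N} -> ~ {subset N <= M} ->
  (forall L : {pred H}, submod_closed L -> {subset M <= L} -> {subset L <= N} ->
     L =i M \/ L =i N) ->
  exists2 x, x \in N & forall y, y \in N -> pi *: y \in M /\ exists b, y - b *: x \in M.
Proof.
move=> [M0 M_lin] [N0 N_lin] MN NM simpleN.
have [x xN xM] : exists2 x, x \in N & x \notin M.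
  apply: contrapT => nex; apply: NM => x xN; apply: contrapT => xM.
  by apply: nex; exists x => //; apply/negP.
(* The submodule generated by [M] and [b0 *: x], needed for [b0 = 1] and [b0 = pi]. *)
pose gen (b0 : R) : {pred H} := fun y => `[< exists b, y - (b * b0) *: x \in M >].
have gen_sub b0 : submod_closed (gen b0).
  split; first by apply/asboolP; exists 0; rewrite mul0r scale0r subr0.
  move=> c u v /asboolP[b1 ub] /asboolP[b2 vb]; apply/asboolP; exists (c * b1 + b2).
  have -> : c *: u + v - ((c * b1 + b2) * b0) *: x =
      c *: (u - (b1 * b0) *: x) + (v - (b2 * b0) *: x).
    by rewrite scalerBr scalerA mulrDl scalerDl opprD addrACA mulrA.
  exact: M_lin.
have Mgen b0 : {subset M <= gen b0}.
  by move=> y yM; apply/asboolP; exists 0; rewrite mul0r scale0r subr0.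
have genN b0 : {subset gen b0 <= N}.
  move=> y /asboolP[b yb].
  rewrite -[y](subrK ((b * b0) *: x)) addrC; apply: N_lin => //.
  exact: MN.
have gen1 : gen 1 =i N.
  case: (simpleN _ (gen_sub 1) (Mgen 1) (genN 1)) => // gM.
  case/negP: xM; rewrite -gM; apply/asboolP; exists 1.
  by rewrite mulr1 scale1r subrr.
have pix : pi *: x \in M.
  case: (simpleN _ (gen_sub pi) (Mgen pi) (genN pi)) => gpi.
    by rewrite -gpi; apply/asboolP; exists 1; rewrite mul1r subrr.
  have /asboolP[b xb] : x \in gen pi by rewrite gpi.
  have u : 1 - b * pi \is a GRing.unit.
    by rewrite dvr_unitE rmorphB rmorphM red_uniformizer mulr0 subr0 rmorph1 oner_eq0.
  case/negP: xM; rewrite -[x]scale1r -(mulVr u) -scalerA scalerBl scale1r.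
  by rewrite -[_ *: _]addr0; apply: M_lin.
exists x => // y; rewrite -gen1 => /asboolP[b]; rewrite mulr1 => yb; split; last by exists b.
rewrite -[y](subrK (b *: x)) scalerDr; apply: (M_lin) => //.
rewrite scalerA mulrC -scalerA -[_ *: _]addr0; exact: M_lin.
Qed.

(** Along the composition series, each step adds the finitely many multiples of one [x] by lifts of
    residues, and costs one more power of [pi]. *)
Lemma finite_length_finite : finite_length H ->
  finite_set [set: H] /\ exists N, forall x : H, pi ^+ N *: x = 0.
Proof.
case=> l [M [M_sub M0 Ml M_step]].
have [lift liftK] := residue_lift.
suff fin i : (i <= l)%N -> finite_set [set x | x \in M i] /\
    forall x, x \in M i -> pi ^+ i *: x = 0.
  have [finl kill] := fin l (leqnn l); split; last by exists l => x; apply: kill.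
  by apply: sub_finite_set finl => x _ /=; apply: Ml.
elim: i => [|i IHi] il.
  split=> [|x]; last by rewrite M0 => /eqP ->; rewrite scaler0.
  by apply: sub_finite_set (finite_set1 0) => x /=; rewrite M0 => /eqP ->.
have [fin_i kill_i] := IHi (ltnW il); have [MN NM simple] := M_step i il.
have [x xN xE] := composition_step (M_sub i (ltnW il)) (M_sub _ il) MN NM simple.
split; last by move=> y /xE[piy _]; rewrite exprSr -scalerA kill_i.
have : finite_set ((fun cy : F * H => lift cy.1 *: x + cy.2) @`
    ([set: F] `*` [set y | y \in M i])).
  by apply: finite_image; apply: finite_setX => //; apply: finite_finset.
apply: sub_finite_set => y /= yM; have [_ [b yb]] := xE y yM.
exists (red b, y - lift (red b) *: x); last by rewrite /= addrC subrK.
split => //=.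
have /piE[c bE] : b - lift (red b) \in m.
  by rewrite red_ker rmorphB liftK subrr.
have -> : y - lift (red b) *: x = c *: (pi *: x) + (y - b *: x).
  by rewrite scalerA -bE scalerBl [RHS]addrC addrA subrK.
have [_ M_lin] := M_sub i (ltnW il); apply: M_lin => //.
by have [] := xE x xN.
Qed.

End FiniteLength.

End DiscreteValuationRing.

(** * Presentations of a module by square matrices *)

(** The leading coordinates of the elements of [K] form an ideal. An element whose leading
    coordinate generates it is the first column; subtracting multiples of it leaves the part of [K]
    with leading coordinate 0. Columns may vanish, so a square matrix suffices. *)
Lemma submodule_image (R : idomainType) n (K : 'cV[R]_n -> Prop) :
  (forall I : {pred R}, is_ideal I -> principal_ideal I) ->
  K 0 -> (forall a u v, K u -> K v -> K (a *: u + v)) ->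
  exists M : 'M[R]_n, forall v, K v <-> exists w, v = M *m w.
Proof.
move=> pid; elim: n K => [|n IHn] K K0 K_lin.
  exists 0 => v; split=> [_|_]; first by exists 0; rewrite [v]flatmx0 [RHS]flatmx0.
  by rewrite [v]flatmx0 -(flatmx0 0).
change ('cV[R]_(1 + n) -> Prop) in K.
pose I : {pred R} := fun x => `[< exists2 v, K v & v 0 0 = x >].
have I_ideal : is_ideal I.
  split; first by apply/asboolP; exists 0; rewrite ?mxE.
  move=> a x y /asboolP[u Ku ux] /asboolP[v Kv vy]; apply/asboolP.
  by exists (a *: u + v); rewrite ?mxE ?ux ?vy //; apply: K_lin.
have [a aE] := pid I I_ideal.
have [v0 Kv0 v0a] : exists2 v, K v & v 0 0 = a.
  by apply/asboolP/aE; exists 1; rewrite mul1r.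
have [|u w x Ku Kw|M ME] := IHn (fun w : 'cV[R]_n => K (col_mx 0 w)).
- by rewrite col_mx0.
- have -> : col_mx 0 (u *: w + x) = u *: col_mx 0 w + col_mx 0 x :> 'cV[R]_(1 + n).
    by rewrite scale_col_mx add_col_mx scaler0 addr0.
  exact: K_lin.
have mulE (b : 'cV[R]_1) (w : 'cV[R]_n) :
    row_mx v0 (col_mx 0 M) *m col_mx b w = b 0 0 *: v0 + col_mx 0 (M *m w).
  rewrite mul_row_col mul_col_mx mul0mx {1}[b]mx11_scalar mul_mx_scalar.
  by [].
exists (row_mx v0 (col_mx 0 M)) => v; split=> [Kv|[w ->]]; last first.
  rewrite -[w](@vsubmxK _ 1 n 1) mulE; apply: K_lin => //.
  by apply/ME; exists (dsubmx (w : 'cV[R]_(1 + n))).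
have [b vb] : exists b, v 0 0 = b * a by apply/aE/asboolP; exists v.
pose z : 'cV[R]_(1 + n) := v - b *: v0.
have zE : z = col_mx 0 (dsubmx z).
  rewrite -[LHS]vsubmxK; congr col_mx; apply/matrixP => i j.
  rewrite !ord1 !mxE; have -> : lshift n 0 = 0 :> 'I_(1 + n) by apply/val_inj.
  by rewrite vb v0a subrr.
have /ME[w wE] : K (col_mx 0 (dsubmx z)).
  by rewrite -zE /z addrC -scaleNr; apply: K_lin.
exists (col_mx b%:M w : 'cV[R]_(1 + n)); rewrite mulE mxE eqxx -wE -zE /z.
by rewrite addrC subrK.
Qed.

Section LinearCombination.
Variables (R : comNzRingType) (H : lmodType R) (n : nat).

Definition lincomb (e : 'I_n -> H) (v : 'cV[R]_n) : H := \sum_i v i 0 *: e i.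

Lemma lincomb_linear e : linear (lincomb e).
Proof.
move=> a u v; rewrite /lincomb scaler_sumr -big_split /=.
by apply: eq_bigr => i _; rewrite !mxE scalerDl scalerA.
Qed.

Lemma lincombD e u v : lincomb e (u + v) = lincomb e u + lincomb e v.
Proof. by have := lincomb_linear e 1 u v; rewrite !scale1r. Qed.

Lemma lincomb0 e : lincomb e 0 = 0.
Proof. by rewrite /lincomb big1 // => i _; rewrite mxE scale0r. Qed.

Lemma lincombZ e a u : lincomb e (a *: u) = a *: lincomb e u.
Proof. by have := lincomb_linear e a u 0; rewrite lincomb0 !addr0. Qed.

Lemma lincombB e u v : lincomb e (u - v) = lincomb e u - lincomb e v.
Proof. by have := lincombZ e (-1) v; rewrite !scaleN1r lincombD => ->. Qed.

Lemma lincomb_delta e i : lincomb e (delta_mx i 0) = e i.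
Proof.
rewrite /lincomb (bigD1 i) //= mxE !eqxx scale1r big1 ?addr0 // => j ji.
by rewrite mxE (negPf ji) scale0r.
Qed.

Lemma eq_lincomb e (f : 'cV[R]_n -> H) : linear f ->
  (forall i, f (delta_mx i 0) = e i) -> forall v, f v = lincomb e v.
Proof.
move=> f_lin fe v.
have f0 : f 0 = 0.
  by have := f_lin (-1) 0 0; rewrite !scaleN1r oppr0 addr0 addNr.
have vE : v = \sum_i v i 0 *: delta_mx i 0.
  by rewrite [LHS]matrix_sum_delta; apply: eq_bigr => i _; rewrite big_ord1.
rewrite [in LHS]vE /lincomb.
elim/big_rec2: _ => [//|i y x _ <-]; by rewrite f_lin fe.
Qed.

Definition generates (e : 'I_n -> H) : Prop := forall x, exists v, lincomb e v = x.

Definition is_presentation (e : 'I_n -> H) (B : 'M[R]_n) : Prop :=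
  forall v, lincomb e v = 0 <-> exists w, v = B *m w.

Lemma coker_isom_presentation (B : 'M[R]_n) :
  lmod_isom (coker B) H <-> exists2 e, generates e & is_presentation e B.
Proof.
split=> [[f f_bij]|[e e_gen eB]].
  have [g fK gK] := f_bij.
  pose e i := f (\pi_(coker B) (delta_mx i 0)%R)%qT.
  have fe : forall v, f (\pi_(coker B) v)%qT = lincomb e v.
    apply: (eq_lincomb (f := fun v => f (\pi_(coker B) v)%qT)) => // a u v.
    by rewrite -coker_piD -coker_pi_scale linearP.
  have pi0 : (0 : coker B) = (\pi_(coker B) 0)%qT.
    by have := coker_pi_scale B 0 0; rewrite scaler0 => <-;
      rewrite -[LHS](scale0r (\pi_(coker B) 0)%qT).
  exists e.
    move=> x; exists (repr (g x)); rewrite -fe reprK; exact: gK.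
  move=> v; rewrite -fe; split=> [fv0|[w vw]].
    have : (\pi_(coker B) v)%qT = (\pi_(coker B) 0)%qT.
      by apply: (bij_inj f_bij); rewrite fv0 -pi0 linear0.
    by move/coker_eqP; rewrite subr0 => /asboolP.
  rewrite (_ : (\pi_(coker B) v)%qT = 0) ?linear0 // pi0; apply/coker_eqP.
  by rewrite subr0; apply/asboolP; exists w.
have repr_pi v : lincomb e (repr (\pi_(coker B) v)%qT) = lincomb e v.
  apply/eqP; rewrite -subr_eq0 -lincombB; apply/eqP/eB/asboolP.
  by apply/coker_eqP; rewrite reprK.
pose f (x : coker B) : H := lincomb e (repr x).
have f_lin : linear f.
  move=> a x y; rewrite /f -{1}[x]reprK -{1}[y]reprK.
  by rewrite [a *: _](coker_pi_scale B) coker_piD repr_pi lincomb_linear.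
pose fL : {linear coker B -> H} :=
  HB.pack f (GRing.isLinear.Build R (coker B) H _ f f_lin).
exists fL; have [s sK] := choice e_gen.
exists (fun y => \pi_(coker B) (s y))%qT => [x|y] /=; last by rewrite /f repr_pi sK.
rewrite -[RHS]reprK; apply/coker_eqP/asboolP/eB.
by rewrite lincombB sK subrr.
Qed.

Lemma coker_zeroE (B : 'M[R]_n) :
  zero_module (coker B) <-> exists B', B *m B' = 1%:M.
Proof.
have z : zero_module (coker B) <-> forall v : 'cV[R]_n, exists w, v = B *m w.
  split=> [B0 v|B0].
    have /coker_eqP : (\pi_(coker B) v)%qT = (\pi_(coker B) 0)%qT.
      exact: (etrans (B0 _) (esym (B0 _))).
    by rewrite subr0 => /asboolP.
  move=> x; rewrite -[x]reprK -[0]reprK; apply/coker_eqP/asboolP; exact: B0.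
rewrite z; split=> [B0|[B' BB'] v]; last by exists (B' *m v); rewrite mulmxA BB' mul1mx.
have [w wE] := choice (fun j : 'I_n => B0 (delta_mx j 0)).
exists (\matrix_(i, j) w j i 0); apply/matrixP => i j.
have /matrixP/(_ i 0) := wE j; rewrite !mxE eqxx andbT => ->.
by apply: eq_bigr => k _; rewrite mxE.
Qed.

End LinearCombination.

(** * Generating families and their kernels *)

Section CountPresentations.
Variables (R : comNzRingType) (H : lmodType R) (T : finType) (g : T -> H).
Hypothesis g_bij : bijective g.
Variable N : nat.
Implicit Types h : {ffun 'I_N -> T}.

Definition family_of h : 'I_N -> H := fun i => g (h i).

Definition generating : {set {ffun 'I_N -> T}} :=
  [set h | `[< generates (family_of h) >]].

Definition same_kernel h h' : bool :=
  `[< forall v, lincomb (family_of h) v = 0 <-> lincomb (family_of h') v = 0 >].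

Lemma generatingP h : reflect (generates (family_of h)) (h \in generating).
Proof. by rewrite inE; apply: asboolP. Qed.

(** Two surjections onto [H] with the same kernel differ by exactly one automorphism of [H]. *)
Lemma card_same_kernel h : h \in generating ->
  #|[set h' in generating | same_kernel h h']| = card_Aut H.
Proof.
move=> /generatingP /choice[s sK]; have [g' gK g'K] := g_bij.
set X := [set _ in _ | _].
(* The automorphism carrying [h] to [h']: lift along [h] by the section [s], then apply [h']. By
   [fE] it does not depend on the lift. *)
pose f (h' : {ffun 'I_N -> T}) (x : H) := lincomb (family_of h') (s x).
have fE h' v : same_kernel h h' -> f h' (lincomb (family_of h) v) = lincomb (family_of h') v.
  move=> /asboolP hh'; apply/eqP; rewrite -subr_eq0 -lincombB; apply/eqP/hh'.
  by rewrite lincombB sK subrr.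
have AutE : @Aut_mod R H = [set` [fset f h' | h' in X]%fset]%classic.
  apply/seteqP; split => [u [u_lin u_bij]|u /= /imfsetP[h' /= h'X ->]].
    have [u' uK u'K] := u_bij.
    have u0 : u 0 = 0.
      by have := u_lin (-1) 0 0; rewrite !scaleN1r oppr0 addr0 addNr.
    pose h' := [ffun i => g' (u (family_of h i))].
    have uE v : u (lincomb (family_of h) v) = lincomb (family_of h') v.
      apply: (eq_lincomb (f := fun v => u (lincomb (family_of h) v))) => [a w z|i].
        by rewrite lincomb_linear u_lin.
      by rewrite lincomb_delta /family_of ffunE g'K.
    apply/imfsetP; exists h'; last by apply/funext => x; rewrite /f -uE sK.
    rewrite inE; apply/andP; split.
      by apply/generatingP => y; exists (s (u' y)); rewrite -uE sK u'K.
    apply/asboolP => v; rewrite -uE; split=> [->//|uv].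
    by apply: (bij_inj u_bij); rewrite uv u0.
  move: h'X; rewrite inE => /andP[/generatingP/choice[s' s'K] hh'].
  have f_lin : linear (f h').
    move=> a x y; rewrite -{1}[x]sK -{1}[y]sK -lincomb_linear fE //.
    by rewrite lincomb_linear.
  split=> //; exists (fun y => lincomb (family_of h) (s' y)) => [x|y]; last by rewrite fE ?s'K.
  rewrite -[RHS]sK; apply/eqP; rewrite -subr_eq0 -lincombB; apply/eqP.
  by move/asboolP: hh' => hh'; apply/hh'; rewrite lincombB s'K subrr.
rewrite /card_Aut AutE set_fsetK card_in_imfset /=; last first.
  move=> h1 h2; rewrite !inE => /andP[_ hh1] /andP[_ hh2] f12; apply/ffunP => i.
  apply: (can_inj gK); rewrite -[LHS](lincomb_delta (family_of h1) i).
  by rewrite -fE // f12 fE // lincomb_delta.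
by rewrite cardE.
Qed.

(** The entries of a non-generating family lie in a proper submodule [D], which is disjoint from a
    translate of itself and so fills at most half of [H]. The union bound runs over all subsets of
    at most half size, which is enough as [T] stays fixed while [N] grows. *)
Lemma card_not_generating :
  (#|~: generating| * 2 ^ N <= 2 ^ #|T| * #|T| ^ N)%N.
Proof.
have [g' gK g'K] := g_bij.
pose small := [set D : {set T} | (#|D| * 2 <= #|T|)%N].
have sub : ~: generating \subset \bigcup_(D in small) [set h | ffun_on (mem D) h].
  apply/fintype.subsetP => h; rewrite inE => /generatingP h_ng.
  have [x xh] : exists x, forall v, lincomb (family_of h) v <> x.
    apply: contrapT => nex; apply: h_ng => x; apply: contrapT => nv.
    by apply: nex; exists x => v vx; apply: nv; exists v.
  pose D := [set t | `[< exists v, g t = lincomb (family_of h) v >]].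
  apply/finset.bigcupP; exists D; last first.
    rewrite inE; apply/ffun_onP => i; rewrite inE; apply/asboolP.
    by exists (delta_mx i 0); rewrite lincomb_delta.
  rewrite inE muln2 -addnn -(cardsC D) leq_add2l.
  have inj : injective (fun t => g' (x + g t)).
    by move=> t1 t2 /(can_inj g'K) /addrI /(can_inj gK).
  rewrite -(card_imset _ inj); apply: subset_leq_card; apply/fintype.subsetP => _ /imsetP[t + ->].
  rewrite inE => /asboolP[v gt]; rewrite !inE; apply/asboolP => -[w].
  rewrite g'K => xw; apply: (xh (w - v)); by rewrite lincombB -xw gt addrK.
apply: (@leq_trans ((\sum_(D in small) #|[set h | ffun_on (mem D) h]|) * 2 ^ N)%N).
  rewrite leq_mul2r; apply/orP; right; apply: leq_trans (subset_leq_card sub) _.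
  exact: leq_card_bigcup.
rewrite big_distrl /=; apply: (@leq_trans (\sum_(D in small) #|T| ^ N)%N).
  apply: leq_sum => D; rewrite inE => D2.
  rewrite cardsE card_ffun_on card_ord -expnMn.
  by have [->|N0] := posnP N; rewrite ?expn0 // leq_exp2r.
rewrite sum_nat_const leq_mul2r -[X in (_ <= 2 ^ X)%N]cardsT -card_powerset.
by rewrite powersetT cardsT max_card orbT.
Qed.

End CountPresentations.

Section PresentationMatrix.
Variables (R : idomainType) (m : {pred R}).
Hypothesis m_dvr : is_dvr m.
Variables (F : finFieldType) (red : {rmorphism R -> F}).
Hypothesis red_ker : forall x : R, (x \in m) = (red x == 0).
Variables (pi : R) (lift : F -> R).
Hypothesis pi_neq0 : pi != 0.
Hypothesis piE : forall x, x \in m <-> exists b, x = b * pi.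
Hypothesis liftK : cancel lift red.
Variables (H : lmodType R) (T : finType) (g : T -> H).
Hypothesis g_bij : bijective g.
Variables (N : nat).
Hypothesis piN : forall x : H, pi ^+ N *: x = 0.
Variable (n : nat) (e : 'I_n -> H) (M : 'M[R]_n).
Hypothesis e_gen : generates e.
Hypothesis eM : is_presentation e M.

Let q := #|F|.

Lemma map_lift_red k l (A : 'M[F]_(k, l)) : map_mx red (map_mx lift A) = A.
Proof. by apply/matrixP => i j; rewrite !mxE liftK. Qed.

(** The cokernel of [M] modulo the maximal ideal is a quotient of [H]. The map [f] need not be
    additive, as [lift] need not be, but two vectors with the same value under [f] differ by an
    element of the column space of the residue of [M]. *)
Lemma presentation_card_rank : (q ^ n <= #|T| * q ^ \rank (map_mx red M))%N.
Proof.
have [g' gK g'K] := g_bij.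
pose f (v : 'cV[F]_n) : T := g' (lincomb e (map_mx lift v)).
pose im := [set v : 'cV[F]_n | v^T \in rowg (map_mx red M)^T].
have card_im : #|im| = (q ^ \rank (map_mx red M))%N.
  rewrite -mxrank_tr -card_rowg -(card_imset _ (@trmx_inj F n 1)).
  apply: eq_card => v; apply/imsetP/idP => [[w + ->]|vM]; first by rewrite inE.
  by exists v^T; rewrite ?trmxK // inE trmxK.
have fiber (t : T) : (#|[set v | f v == t]| <= q ^ \rank (map_mx red M))%N.
  have [->|[v0]] := set_0Vmem [set v | f v == t]; first by rewrite cards0.
  rewrite inE => /eqP v0t; rewrite -card_im.
  rewrite -(card_imset _ (addIr (- v0))); apply: subset_leq_card.
  apply/fintype.subsetP => _ /imsetP[v + ->]; rewrite inE => /eqP vt; rewrite inE.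
  have [w wE] : exists w, map_mx lift v - map_mx lift v0 = M *m w.
    apply/eM; rewrite lincombB; apply/eqP; rewrite subr_eq0; apply/eqP.
    by apply: (can_inj g'K); rewrite -/(f v) -/(f v0) vt v0t.
  move/(congr1 (fun A => (map_mx red A)^T)): wE.
  rewrite map_mxB !map_lift_red map_mxM trmx_mul => ->.
  by rewrite inE submxMl.
have -> : (q ^ n)%N = #|[set: 'cV[F]_n]| by rewrite cardsT card_mx muln1.
have -> : [set: 'cV[F]_n] = \bigcup_(t : T) [set v | f v == t].
  by apply/setP => v; rewrite inE; apply/esym/finset.bigcupP; exists (f v); rewrite ?inE.
apply: leq_trans (leq_card_bigcup _ _) _; apply: leq_trans (leq_sum _ _) _.
  by move=> t _; apply: fiber.
by rewrite sum_nat_const.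
Qed.

(** As [pi ^+ N] kills [H], it maps [R^n] into the image of [M]. This yields both [\det M != 0] and
    the openness of the cosets below. *)
Lemma presentation_pi : exists M' : 'M[R]_n, M *m M' = (pi ^+ N)%:M.
Proof.
have ex (j : 'I_n) : exists w : 'cV[R]_n, pi ^+ N *: delta_mx j 0 = M *m w.
  by apply/eM; rewrite lincombZ piN.
have [w wE] := choice ex; exists (\matrix_(i, j) w j i 0); apply/matrixP => i j.
have /matrixP/(_ i 0) := wE j; rewrite !mxE andbT mulr_natr => ->.
by apply: eq_bigr => k _; rewrite mxE.
Qed.

Lemma presentation_mulmx_inj k : injective (fun X : 'M[R]_(n, k) => M *m X).
Proof.
have [M' MM'] := presentation_pi.
have det0 : \det M != 0.
  have := congr1 determinant MM'; rewrite det_mulmx det_scalar => detE.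
  have : \det M * \det M' != 0 by rewrite detE !expf_neq0.
  by rewrite mulf_eq0 negb_or => /andP[].
move=> X Y MXY; apply/eqP; rewrite -subr_eq0.
have : \adj M *m (M *m (X - Y)) = 0 by rewrite mulmxBr MXY subrr mulmx0.
rewrite mulmxA mul_adj_mx mul_scalar_mx => /matrixP XY.
apply/eqP/matrixP => i j; have /eqP := XY i j; rewrite !mxE mulf_eq0 (negPf det0) /=.
by move/eqP.
Qed.

(** Equal images give [A = M *m B] and [M = A *m B']; cancelling [M] makes [B] invertible, which is
    visible on its residue. *)
Lemma is_presentationE (A : 'M[R]_n) :
  is_presentation e A <-> exists2 B, A = M *m B & map_mx red B \in unitmx.
Proof.
split=> [eA|[B AE Bu]].
  have [B BE] : exists B, A = M *m B.
    have ex (j : 'I_n) : exists w : 'cV[R]_n, A *m delta_mx j 0 = M *m w.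
      by apply/eM/eA; exists (delta_mx j 0).
    have [w wE] := choice ex; exists (\matrix_(i, j) w j i 0); apply/matrixP => i j.
    have /matrixP/(_ i 0) := wE j; rewrite -colE !mxE => ->.
    by apply: eq_bigr => k _; rewrite mxE.
  have [B' BE'] : exists B', M = A *m B'.
    have ex (j : 'I_n) : exists w : 'cV[R]_n, M *m delta_mx j 0 = A *m w.
      by apply/eA/eM; exists (delta_mx j 0).
    have [w wE] := choice ex; exists (\matrix_(i, j) w j i 0); apply/matrixP => i j.
    have /matrixP/(_ i 0) := wE j; rewrite -colE !mxE => ->.
    by apply: eq_bigr => k _; rewrite mxE.
  exists B => //; rewrite -(dvr_unitmx m_dvr red_ker).
  have /mulmx1_unit[] : B *m B' = 1%:M.
    by apply: presentation_mulmx_inj; rewrite mulmxA -BE -BE' mulmx1.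
  by [].
move: Bu; rewrite -(dvr_unitmx m_dvr red_ker) => Bu v; rewrite eM; split=> [[w ->]|[w ->]].
  by exists (invmx B *m w); rewrite AE mulmxA mulmxK.
by exists (B *m w); rewrite mulmxA AE.
Qed.

(** * Haar measure of the cosets of a presentation *)

Section Haar.
Variables (K : realType) (mu : probability (borel_mx m n) K).
Hypothesis mu_haar : haar_probability mu.
Local Open Scope classical_set_scope.
Local Open Scope ring_scope.

Definition pres_coset (X : 'M[R]_n) : set (borel_mx m n) :=
  [set A | exists C : 'M[R]_n, A = X + M *m (pi *: C)].

(** The coset is open: [pi ^+ N.+1] is [pi] times a right multiple of [M], so perturbations
    divisible by [pi ^+ N.+1] stay inside. *)
Lemma pres_coset_measurable X : measurable (pres_coset X).
Proof.
have [M' MM'] := presentation_pi.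
apply: sub_sigma_algebra => _ [C ->]; exists N.+1 => B BA.
have ex (ij : 'I_n * 'I_n) : exists b,
    B ij.1 ij.2 - (X + M *m (pi *: C)) ij.1 ij.2 = b * pi ^+ N.+1.
  exact: (ideal_exp_uniformizer piE (BA ij.1 ij.2)).
have [D DE] := choice ex; exists (C + M' *m \matrix_(i, j) D (i, j)).
rewrite scalerDr mulmxDr addrA; apply/eqP; rewrite addrC -subr_eq; apply/eqP.
rewrite -[RHS]scalemxAr mulmxA MM' mul_scalar_mx scalerA -exprS.
by apply/matrixP => i j; have := DE (i, j); rewrite /= mulrC !mxE.
Qed.

Lemma pres_coset_measure X : mu (pres_coset X) = mu (pres_coset 0).
Proof.
rewrite -(mu_haar X (pres_coset_measurable 0)); congr (mu _).
apply/seteqP; split => [A [C ->]|_ [_ [C ->] <-]]; last by exists C; rewrite add0r.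
by exists (M *m (pi *: C)) => //; exists C; rewrite add0r.
Qed.

Lemma measure_bigcup_coset (I : finType) (P : {set I}) (X : I -> 'M[R]_n) :
  trivIset [set` P] (fun i => pres_coset (X i)) ->
  measurable (\bigcup_(i in [set` P]) pres_coset (X i)) /\
  mu (\bigcup_(i in [set` P]) pres_coset (X i)) = (#|P|%:R%:E * mu (pres_coset 0))%E.
Proof.
move=> triv; split.
  by apply: fin_bigcup_measurable => [|i _]; [exact: finite_finpred|exact: pres_coset_measurable].
rewrite measure_fin_bigcup //; last by move=> i _; exact: pres_coset_measurable.
have muE : mu (pres_coset 0) = (fine (mu (pres_coset 0)))%:E.
  by rewrite fineK // fin_num_measure //; exact: pres_coset_measurable.
have -> : [set` P] = [set` enum P] by apply/seteqP; split=> i /=; rewrite mem_enum.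
rewrite -fsbig_seq ?enum_uniq // big_enum /= muE.
under eq_bigr do rewrite pres_coset_measure muE.
by rewrite sumEFin sumr_const -EFinM mulr_natl.
Qed.

Section Residues.
Variables (a : R) (good : pred 'M[F]_n).

Definition pres_reps : {set 'M[F]_n} :=
  [set S | (S \in unitmx) && good (map_mx red (a%:M) + map_mx red M *m S)]%SET.

(** Writing [A = a%:M + M *m B], both conditions depend only on the residue [S] of [B], and fixing
    [S] describes one coset. *)
Lemma presentation_set_bigcup :
  [set A : 'M[R]_n | is_presentation e (A - a%:M) /\ good (map_mx red A)] =
  \bigcup_(S in [set` pres_reps]) pres_coset (a%:M + M *m map_mx lift S).
Proof.
apply/seteqP; split=> [A /= [/is_presentationE[B AB Bu] Ag]|A [S]].
  have AE : A = a%:M + M *m B by rewrite -AB addrC subrK.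
  exists (map_mx red B).
    by rewrite /= inE Bu /= -map_mxM -map_mxD -AE.
  have [C CE] : exists C, B - map_mx lift (map_mx red B) = pi *: C.
    by apply/(map_mx_red0 red_ker piE); rewrite map_mxB map_lift_red subrr.
  by exists C; rewrite -CE mulmxBr -addrA [X in _ + X]addrC subrK -AE.
rewrite /= inE => /andP[Su Sg] [C AE].
have AE' : A = a%:M + M *m (map_mx lift S + pi *: C) by rewrite mulmxDr addrA.
have redB : map_mx red (map_mx lift S + pi *: C) = S.
  have /(map_mx_red0 red_ker piE) C0 : exists C', pi *: C = pi *: C' by exists C.
  by rewrite map_mxD map_lift_red C0 addr0.
split; last by rewrite AE' map_mxD map_mxM redB.
apply/is_presentationE; exists (map_mx lift S + pi *: C); last by rewrite redB.
by rewrite AE' addrC addKr.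
Qed.

Lemma pres_coset_disjoint (I : Type) (D : set I) (X : I -> 'M[R]_n) :
  (forall i j C, D i -> D j -> X i - X j = M *m (pi *: C) -> i = j) ->
  trivIset D (fun i => pres_coset (X i)).
Proof.
move=> XD i j Di Dj [A [[C AC] [C' AC']]]; apply: (XD _ _ (C' - C)) => //.
have -> : X i = A - M *m (pi *: C) by rewrite AC addrK.
have -> : X j = A - M *m (pi *: C') by rewrite AC' addrK.
by rewrite scalerBr mulmxBr opprB addrC addrA subrK.
Qed.

Lemma lincomb_mulmx (w : 'cV[R]_n) : lincomb e (M *m w) = 0.
Proof. by apply/eM; exists w. Qed.

(* The cosets of [M m Mat_n(R)] are indexed by [H^n = Mat_n(R) / M Mat_n(R)] and
   [Mat_n(F) = M Mat_n(R) / M m Mat_n(R)]. *)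
Lemma pres_coset0_measure :
  mu (pres_coset 0) = ((#|T| ^ n * q ^ (n * n))%:R^-1)%:E.
Proof.
have [g' gK g'K] := g_bij; have [s sK] := choice e_gen.
(* Column [j] lifts the element [g (fS.1 j)] of [H]; the second term moves it inside the image of
   [M], by a residue class. *)
pose X (fS : {ffun 'I_n -> T} * 'M[F]_n) : 'M[R]_n :=
  \matrix_(i, j) s (g (fS.1 j)) i 0 + M *m map_mx lift fS.2.
have colX fS j : lincomb e (X fS *m delta_mx j 0) = g (fS.1 j).
  rewrite mulmxDl -mulmxA lincombD lincomb_mulmx addr0 -colE -[RHS]sK; congr lincomb.
  by apply/matrixP => i k; rewrite !mxE !ord1.
have [Xm Xmu] : measurable (\bigcup_(fS in [set` [set: {ffun 'I_n -> T} * 'M[F]_n]%SET])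
      pres_coset (X fS)) /\
    mu (\bigcup_(fS in [set` [set: {ffun 'I_n -> T} * 'M[F]_n]%SET]) pres_coset (X fS)) =
    (#|[set: {ffun 'I_n -> T} * 'M[F]_n]%SET|%:R%:E * mu (pres_coset 0))%E.
  apply: measure_bigcup_coset; apply: pres_coset_disjoint.
  move=> [f1 S1] [f2 S2] C _ _ XC.
  have f12 : f1 = f2.
    apply/ffunP => j; apply: (can_inj gK); rewrite -(colX (f1, S1)) -(colX (f2, S2)).
    apply/eqP; rewrite -subr_eq0 -lincombB -mulmxBl XC -mulmxA lincomb_mulmx.
    by [].
  subst f2; congr pair; move: XC; rewrite /X /= opprD addrACA subrr add0r -mulmxBr.
  move/presentation_mulmx_inj/(congr1 (map_mx red)).
  rewrite map_mxB !map_lift_red => SC; apply/eqP; rewrite -subr_eq0 SC; apply/eqP.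
  by apply/(map_mx_red0 red_ker piE); exists C.
have cover : \bigcup_(fS in [set` [set: {ffun 'I_n -> T} * 'M[F]_n]%SET])
    pres_coset (X fS) = setT.
  apply/seteqP; split => // A _.
  pose f := [ffun j => g' (lincomb e (A *m delta_mx j 0))].
  have [B BE] : exists B, A - \matrix_(i, j) s (g (f j)) i 0 = M *m B.
    have ex (j : 'I_n) : exists w : 'cV[R]_n,
        (A - \matrix_(i, j) s (g (f j)) i 0) *m delta_mx j 0 = M *m w.
      apply/eM; rewrite mulmxBl lincombB; apply/eqP; rewrite subr_eq0; apply/eqP.
      transitivity (g (f j)); first by rewrite ffunE g'K.
      rewrite -[LHS]sK -colE; congr lincomb.
      by apply/matrixP => i k; rewrite !mxE !ord1.
    have [w wE] := choice ex; exists (\matrix_(i, j) w j i 0); apply/matrixP => i j.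
    have /matrixP/(_ i 0) := wE j; rewrite -colE [X in X = _ -> _]mxE => ->.
    by rewrite !mxE; apply: eq_bigr => k _; rewrite mxE.
  have [C CE] : exists C, B - map_mx lift (map_mx red B) = pi *: C.
    by apply/(map_mx_red0 red_ker piE); rewrite map_mxB map_lift_red subrr.
  exists (f, map_mx red B); first by rewrite /= inE.
  by exists C; rewrite -CE mulmxBr /X /= -addrA [X in _ + X]addrC subrK -BE addrC subrK.
move: Xmu; rewrite cover probability_setT cardsT card_prod card_ffun card_ord card_mx.
have -> : mu (pres_coset 0) = (fine (mu (pres_coset 0)))%:E.
  by rewrite fineK // fin_num_measure //; exact: pres_coset_measurable.
rewrite -EFinM => -[mu1]; congr EFin; set k := (_ * _)%N in mu1 *.
have k0 : k%:R != 0 :> K.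
  by apply/eqP => k0; move/eqP: mu1; rewrite k0 mul0r oner_eq0.
by apply: (mulfI k0); rewrite -mu1 divff.
Qed.

Lemma presentation_set_measure :
  measurable ([set A : 'M[R]_n | is_presentation e (A - a%:M) /\ good (map_mx red A)]
     : set (borel_mx m n)) /\
  mu [set A : 'M[R]_n | is_presentation e (A - a%:M) /\ good (map_mx red A)] =
  (#|pres_reps|%:R / (#|T| ^ n * q ^ (n * n))%:R)%:E.
Proof.
rewrite presentation_set_bigcup.
have [] := @measure_bigcup_coset _ pres_reps (fun S => a%:M + M *m map_mx lift S).
  apply: pres_coset_disjoint => S1 S2 C _ _.
  rewrite opprD addrACA subrr add0r -mulmxBr.
  move/presentation_mulmx_inj/(congr1 (map_mx red)).
  rewrite map_mxB !map_lift_red => SC; apply/eqP; rewrite -subr_eq0 SC; apply/eqP.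
  by apply/(map_mx_red0 red_ker piE); exists C.
by move=> meas ->; rewrite pres_coset0_measure EFinM.
Qed.

End Residues.


End Haar.

End PresentationMatrix.

(** * Decomposition of the cokernel event by kernels *)

Section CokernelEvent.
Variables (R : idomainType) (m : {pred R}).
Hypothesis m_dvr : is_dvr m.
Variables (F : finFieldType) (red : {rmorphism R -> F}).
Hypothesis red_ker : forall x : R, (x \in m) = (red x == 0).
Variables (pi : R) (lift : F -> R).
Hypothesis pi_neq0 : pi != 0.
Hypothesis piE : forall x, x \in m <-> exists b, x = b * pi.
Hypothesis liftK : cancel lift red.
Variables (H : lmodType R) (T : finType) (g : T -> H).
Hypothesis g_bij : bijective g.
Variables (N : nat).
Hypothesis piN : forall x : H, pi ^+ N *: x = 0.
Variable (n : nat).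
Variables (K : realType) (mu : probability (borel_mx m n) K).
Hypothesis mu_haar : haar_probability mu.
Variables (a : R) (good : pred 'M[F]_n).
Local Open Scope classical_set_scope.
Local Open Scope ring_scope.
Let q := #|F|.
Implicit Types h : {ffun 'I_n -> T}.

Definition family_event h : set (borel_mx m n) :=
  [set A : 'M[R]_n | is_presentation (family_of g h) (A - a%:M) /\ good (map_mx red A)].

Lemma generating_presentation h : exists M, is_presentation (family_of g h) M.
Proof.
case: m_dvr => pid _ _.
apply: (@submodule_image R n (fun v => lincomb (family_of g h) v = 0) pid).
  exact: lincomb0.
by move=> b u v u0 v0; rewrite lincomb_linear u0 v0 scaler0 addr0.
Qed.

Lemma same_kernel_event h h' : same_kernel g h h' -> family_event h = family_event h'.
Proof.
move=> /asboolP hh'; apply/seteqP.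
by split=> A [pA gA]; split=> // v; rewrite -pA hh'.
Qed.

Lemma family_event_disjoint h h' A :
  family_event h A -> family_event h' A -> same_kernel g h h'.
Proof. by move=> [pA _] [p'A _]; apply/asboolP => v; rewrite pA p'A. Qed.

(** Extensionally equal predicates get the same [pick], so this representative depends only on the
    kernel of [h]; the default is never reached when [h] is generating. *)
Definition kernel_rep h : {ffun 'I_n -> T} :=
  odflt h [pick h' in generating g n | same_kernel g h h'].

Lemma same_kernel_refl h : same_kernel g h h.
Proof. exact/asboolP. Qed.

Lemma same_kernelW h h' : same_kernel g h h' -> same_kernel g h =1 same_kernel g h'.
Proof.
move=> /asboolP hh' h2; by apply/asboolP/asboolP => e v; rewrite -e ?hh' // -hh'.
Qed.

Lemma kernel_repP h : h \in generating g n ->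
  kernel_rep h \in generating g n /\ same_kernel g h (kernel_rep h).
Proof.
move=> hg; rewrite /kernel_rep; case: pickP => [h' /andP[]//|/(_ h)].
by rewrite hg same_kernel_refl.
Qed.

Lemma kernel_rep_eq h h' : h \in generating g n -> h' \in generating g n ->
  (kernel_rep h == kernel_rep h') = same_kernel g h h'.
Proof.
move=> hg h'g; apply/eqP/idP => [e|hh'].
  have [_ hk] := kernel_repP hg; have [_ h'k] := kernel_repP h'g.
  by rewrite (same_kernelW hk) e -(same_kernelW h'k) same_kernel_refl.
rewrite /kernel_rep.
rewrite (@eq_pick _ _ [pred h2 | (h2 \in generating g n) && same_kernel g h' h2]); last first.
  by move=> h2 /=; rewrite (same_kernelW hh').
by case: pickP => [//|/(_ h')] /=; rewrite h'g same_kernel_refl.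
Qed.

Definition kernel_reps : {set {ffun 'I_n -> T}} :=
  [set h in generating g n | kernel_rep h == h]%SET.

Lemma kernel_rep_in h : h \in generating g n -> kernel_rep h \in kernel_reps.
Proof.
move=> hg; have [kg hk] := kernel_repP hg.
by rewrite inE kg /= kernel_rep_eq // -(same_kernelW hk) same_kernel_refl.
Qed.

Lemma card_kernel_reps : (#|kernel_reps| * card_Aut H)%N = #|generating g n|.
Proof.
rewrite -[RHS]sum1_card (partition_big kernel_rep (mem kernel_reps)) /=; last first.
  exact: kernel_rep_in.
rewrite -sum_nat_const; apply: eq_bigr => h; rewrite inE => /andP[hg /eqP hk].
rewrite -(card_same_kernel g_bij hg) -sum1_card; apply: eq_bigl => h'; rewrite inE.
have [h'g|//] := boolP (h' \in generating g n).
by rewrite /= eq_sym -[X in X == _]hk kernel_rep_eq.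
Qed.

(** The event is the disjoint union, over the kernels, of events whose measure is [Lim / #|T| ^ n]
    up to [eps / #|T| ^ n]. There are at most [#|T| ^ n] kernels, so the errors add up to at most
    [eps]. *)
Lemma cokernel_event_measure (Lim eps : K) :
  (forall M : 'M[F]_n, (q ^ n <= #|T| * q ^ \rank M)%N ->
    `|#|[set S | (S \in unitmx) && good (map_mx red a%:M + M *m S)]%SET|%:R /
        q%:R ^+ (n * n) - Lim| <= eps) ->
  exists2 c : K,
    mu [set A : 'M[R]_n | lmod_isom (coker (A - a%:M)) H /\ good (map_mx red A)] = c%:E &
    `|c - #|kernel_reps|%:R / #|T|%:R ^+ n * Lim| <= eps.
Proof.
move=> approx.
have eps0 : 0 <= eps.
  apply: le_trans (approx 1%:M _); first exact: normr_ge0.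
  by rewrite mxrank1 leq_pmull //; apply/card_gt0P; have [g' _ _] := g_bij; exists (g' 0).
have T0 : 0 < #|T|%:R ^+ n :> K.
  by rewrite exprn_gt0 // ltr0n; apply/card_gt0P; have [g' _ _] := g_bij; exists (g' 0).
have one h : h \in generating g n -> measurable (family_event h) /\
    exists2 c : K, mu (family_event h) = c%:E & `|c - Lim / #|T|%:R ^+ n| <= eps / #|T|%:R ^+ n.
  move=> /generatingP hg; have [M hM] := generating_presentation h.
  have [meas muE] := presentation_set_measure m_dvr red_ker pi_neq0 piE liftK g_bij piN
    hg hM mu_haar a good.
  split=> //; exists (#|pres_reps red M a good|%:R / (#|T| ^ n * q ^ (n * n))%:R) => //.
  have /approx := presentation_card_rank liftK g_bij hM.
  rewrite -/(pres_reps red M a good) => le1.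
  rewrite natrM !natrX invfM mulrCA mulrC -mulrBl normrM.
  by rewrite [X in _ * X]ger0_norm ?invr_ge0 ?(ltW T0) // ler_wpM2r // invr_ge0 ltW.
have -> : [set A : 'M[R]_n | lmod_isom (coker (A - a%:M)) H /\ good (map_mx red A)] =
    \bigcup_(h in [set` kernel_reps]) family_event h.
  have [g' gK g'K] := g_bij.
  apply/seteqP; split=> [A /= [/coker_isom_presentation[e e_gen eA] Ag]|A [h]].
    pose h := [ffun i => g' (e i)].
    have eE : family_of g h = e by apply/funext => i; rewrite /family_of ffunE g'K.
    have hg : h \in generating g n by apply/generatingP; rewrite eE.
    exists (kernel_rep h); first exact: kernel_rep_in.
    rewrite -(same_kernel_event (kernel_repP hg).2); split => //.
    by rewrite eE.
  rewrite /= inE => /andP[/generatingP hg _] [hA Ag]; split=> //.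
  by apply/coker_isom_presentation; exists (family_of g h).
have /choice[c cE] : forall h, exists c : K, h \in generating g n ->
    mu (family_event h) = c%:E /\ `|c - Lim / #|T|%:R ^+ n| <= eps / #|T|%:R ^+ n.
  move=> h; have [/one[_ [c c1 c2]]|hg] := boolP (h \in generating g n); last by exists 0.
  by exists c.
exists (\sum_(h in kernel_reps) c h).
  rewrite measure_fin_bigcup //=; last 2 first.
  - move=> h h' /= hk h'k [A [hA h'A]].
    move: hk; rewrite inE => /andP[hg /eqP hk].
    move: h'k; rewrite inE => /andP[h'g /eqP h'k].
    apply/eqP; have := kernel_rep_eq hg h'g; rewrite hk h'k => ->.
    exact: family_event_disjoint hA h'A.
  - by move=> h; rewrite /= inE => /andP[/one[]].
  have -> : [set` kernel_reps] = [set` enum kernel_reps].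
    by apply/seteqP; split=> i /=; rewrite mem_enum.
  rewrite -fsbig_seq ?enum_uniq // big_enum /= -sumEFin; apply: eq_bigr => h.
  by rewrite inE => /andP[/cE[]].
have -> : #|kernel_reps|%:R / #|T|%:R ^+ n * Lim = \sum_(h in kernel_reps) Lim / #|T|%:R ^+ n.
  by rewrite sumr_const mulrAC -mulrA mulr_natl.
rewrite -sumrB; apply: le_trans (ler_norm_sum _ _ _) _.
apply: (@le_trans _ _ (\sum_(h in kernel_reps) eps / #|T|%:R ^+ n)).
  by apply: ler_sum => h; rewrite inE => /andP[/cE[]].
rewrite sumr_const -[leLHS]mulr_natl mulrA ler_pdivrMr // mulrC ler_wpM2l //.
rewrite -natrX ler_nat -[n in (_ ^ n)%N]card_ord -card_ffun.
exact: max_card.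
Qed.

End CokernelEvent.

(** * The limit *)

Section GeneratingDensity.
Local Open Scope classical_set_scope.
Local Open Scope ring_scope.

Lemma cvg_generating (K : realType) (R : comNzRingType) (H : lmodType R) (T : finType)
    (g : T -> H) : bijective g ->
  #|generating g n.+1|%:R / #|T|%:R ^+ n.+1 @[n --> \oo] --> (1 : K).
Proof.
move=> g_bij; have T0 n : 0 < #|T|%:R ^+ n :> K.
  by rewrite exprn_gt0 // ltr0n; apply/card_gt0P; have [g' _ _] := g_bij; exists (g' 0).
apply: (@squeeze_cvgr _ _ _ _ (fun n => 1 - 2 ^+ #|T| * 2 ^- n.+1) (fun=> 1)).
- apply: nearW => n; have TE : #|T|%:R ^+ n.+1 =
      #|generating g n.+1|%:R + #|~: generating g n.+1|%:R :> K.
    by rewrite -natrD cardsC card_ffun card_ord natrX.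
  have := card_not_generating g_bij n.+1; rewrite -(ler_nat K) !natrM !natrX => le.
  apply/andP; split; last by rewrite ler_pdivrMr // mul1r TE lerDl.
  rewrite ler_pdivlMr // mulrBl mul1r {1}TE lerBlDr lerD2l.
  by rewrite mulrAC ler_pdivlMr // exprn_gt0.
- rewrite -[X in _ --> X]subr0; apply: cvgB; first exact: cvg_cst.
  rewrite -[X in _ --> X](mulr0 (2 ^+ #|T|)); apply: cvgMr.
  rewrite (cvg_shiftS (fun n => 2 ^- n : K)).
  by apply: cvg_inv_expr.
- exact: cvg_cst.
Qed.

Lemma finite_bijection (H : choiceType) : finite_set [set: H] ->
  exists (T : finType) (g : T -> H), bijective g.
Proof.
move=> finH; have inH x : x \in fset_set [set: H] by rewrite in_fset_set //; apply/mem_set.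
by exists (fset_sub_type (fset_set [set: H])), val, (fun x => FSetSub (inH x)) => // x;
  apply: val_inj.
Qed.

End GeneratingDensity.

Local Open Scope classical_set_scope.
Local Open Scope ring_scope.

Theorem theorem3 (K : realType) (R : idomainType) (m : {pred R})
    (hR : complete_dvr m)
    (F : finFieldType) (red : {rmorphism R -> F})
    (hred_surj : forall y : F, exists x : R, red x = y)
    (hred_ker : forall x : R, (x \in m) = (red x == 0))
    (r : nat) (P : 'I_r.+1 -> {poly R})
    (hP_monic : forall j, P j \is monic)
    (hP_distinct : injective (fun j => map_poly red (P j)))
    (hP_irr : forall j, irreducible_poly (map_poly red (P j)))
    (hP_last : (size (P ord_max)).-1 = 1%N)
    (mu : forall n : nat, probability (borel_mx m n) K)
    (hmu : forall n : nat, haar_probability (mu n))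
    (H : lmodType R) (hH : finite_length H) :
  (mu n.+1 [set A : 'M[R]_n.+1 |
      (forall j, j != ord_max -> zero_module (coker (horner_mx A (P j)))) /\
      lmod_isom (coker (horner_mx A (P ord_max))) H])
    @[n --> \oo] -->
  (((card_Aut H)%:R)^-1 *
    \prod_(j < r.+1)
      infprod (fun i : nat => 1 - (#|F|%:R : K) ^- (i * (size (P j)).-1)))%:E.
Proof.
have [m_dvr _] := hR.
have [pi pi_neq0 piE] := dvr_uniformizer m_dvr.
have [sec secK] := residue_lift hred_surj.
have [finH [N piN]] := finite_length_finite m_dvr hred_surj hred_ker piE hH.
have [T [g g_bij]] := finite_bijection finH.
pose a := - (P ord_max)`_0.
have Pmax : P ord_max = 'X - a%:P.
  have sz : size (P ord_max) = 2%N.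
    by move: hP_last (hP_irr ord_max); case: (size _) => [|[|[|?]]].
  apply/polyP => i; rewrite coefB coefX coefC /a.
  case: i => [|[|i]] /=; first by rewrite sub0r opprK.
    by have := monicP (hP_monic ord_max); rewrite lead_coefE sz subr0.
  by rewrite subrr nth_default // sz.
have sizeP j : size (map_poly red (P j)) = size (P j).
  by rewrite size_map_poly_id0 // (monicP (hP_monic j)) rmorph1 oner_neq0.
pose w (j : 'I_r) := widen_ord (leqnSn r) j.
have w_max j : w j != ord_max by rewrite -val_eqE /= ltn_eqF.
pose p (j : 'I_r) := map_poly red (P (w j)).
have P_coprime i j : i != j -> coprimep (map_poly red (P i)) (map_poly red (P j)).
  move=> ij; rewrite irreducible_poly_coprime //; apply/negP => dvd.
  have [szi _] := hP_irr i.
  have := (hP_irr j).2 _ _ dvd; rewrite neq_ltn szi orbT => /(_ isT).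
  rewrite eqp_monic ?monic_map // => /eqP.
  by move/hP_distinct/eqP; rewrite (negPf ij).
have p_irr j : irreducible_poly (p j) by apply: hP_irr.
have p_coprime i j : i != j -> coprimep (p i) (p j).
  move=> ij; apply: P_coprime; apply: contra_neq ij => /(congr1 val) /= wij.
  exact: val_inj.
have p_a j : coprimep (p j) ('X - (red a)%:P).
  have <- : map_poly red (P ord_max) = 'X - (red a)%:P.
    by rewrite Pmax rmorphB /= map_polyX map_polyC.
  exact: P_coprime.
pose good n (A : 'M[F]_n.+1) := [forall j, horner_mx A (p j) \in unitmx].
pose E n : set (borel_mx m n.+1) := [set A : 'M[R]_n.+1 |
  (forall j, j != ord_max -> zero_module (coker (horner_mx A (P j)))) /\
  lmod_isom (coker (horner_mx A (P ord_max))) H].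
have EE n : E n = [set A : 'M[R]_n.+1 |
    lmod_isom (coker (A - a%:M)) H /\ good n (map_mx red A)].
  have hornA A : horner_mx A (P ord_max) = A - a%:M.
    by rewrite Pmax rmorphB /= horner_mx_X horner_mx_C.
  have zeroE A j : zero_module (coker (horner_mx A (P j))) <->
      horner_mx (map_mx red A) (map_poly red (P j)) \in unitmx.
    rewrite -map_horner_mx -(dvr_unitmx m_dvr hred_ker) coker_zeroE.
    split=> [[B' /mulmx1_unit[]]//|Bu]; exists (invmx (horner_mx A (P j))).
    exact: mulmxV.
  rewrite /E; apply/seteqP; split=> A /=; rewrite hornA => -[].
    move=> zP iso; split=> //; apply/forallP => j; apply/zeroE; exact: zP.
  move=> iso /forallP gA; split=> // j; case: (unliftP ord_max j) => [j' -> _|-> /eqP //].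
  apply/zeroE; have -> : lift ord_max j' = w j' by apply: val_inj; exact: lift_max.
  exact: gA.
pose Lim : K := good_limit K p.
have approx eps : 0 < eps -> exists n0, forall n, (n0 <= n)%N ->
    exists2 c : K, mu n.+1 (E n) = c%:E &
      `|c - #|kernel_reps g n.+1|%:R / #|T|%:R ^+ n.+1 * Lim| <= eps.
  move=> eps0; have [n0 n0P] := good_matrices_limit p_irr p_coprime p_a #|T| eps0.
  exists n0 => n /n0P approx; rewrite EE.
  apply: (cokernel_event_measure m_dvr hred_ker pi_neq0 piE secK g_bij piN (hmu n.+1)).
  by move=> M rM; rewrite map_scalar_mx ltW //; apply: approx.
have -> : \prod_(j < r.+1) infprod (fun i : nat => 1 - (#|F|%:R : K) ^- (i * (size (P j)).-1))
    = Lim.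
  rewrite big_ord_recr /= hP_last infprod_euler_lim expr1 mulrC; congr (_ * _).
  apply: eq_bigr => j _; rewrite infprod_euler_lim natrX; congr (euler_lim (_ ^+ _)).
  by rewrite /qdim /p sizeP; have [] := p_irr j; rewrite sizeP; case: (size _) => [|[|?]].
(* If [card_Aut H] were 0, no family would be generating by [card_kernel_reps], whereas the density
   of generating families tends to 1. *)
have Aut0 : (card_Aut H)%:R != 0 :> K.
  have /cvgrPdist_lt/(_ 1 ltr01)[n _ /(_ n (leqnn n)) /= lt1] := @cvg_generating K _ _ _ _ g_bij.
  rewrite pnatr_eq0; apply: contraTneq lt1 => A0.
  by rewrite -(card_kernel_reps g_bij) A0 muln0 mul0r subr0 normr1 ltxx.
have cvg_reps : #|kernel_reps g n.+1|%:R / #|T|%:R ^+ n.+1 * Lim @[n --> \oo] -->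
    (card_Aut H)%:R^-1 * Lim.
  apply: cvgMl; rewrite -[X in _ --> X]mul1r.
  rewrite (_ : (fun n => _) = (fun n => #|generating g n.+1|%:R / #|T|%:R ^+ n.+1 /
    (card_Aut H)%:R)); first by apply: cvgMl; apply: cvg_generating.
  apply/funext => n; rewrite -(card_kernel_reps g_bij) natrM.
  by rewrite mulrAC mulfK.
change (mu n.+1 (E n) @[n --> \oo] --> ((card_Aut H)%:R^-1 * Lim)%:E).
apply/fine_cvgP; split.
  by have [n0 n0P] := approx 1 ltr01; exists n0 => // n /n0P[c -> _].
apply/cvgrPdist_lt => eps eps0.
have eps2 : 0 < eps / 2 by rewrite divr_gt0.
have [n0 n0P] := approx _ eps2.
have near0 : \forall n \near \oo, (n0 <= n)%N by exists n0.
move/cvgrPdist_lt: cvg_reps => /(_ _ eps2); apply: filterS2 near0.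
move=> n /n0P[c cE c_eps] lim_eps; rewrite /= cE /=.
have -> : (card_Aut H)%:R^-1 * Lim - c =
  (card_Aut H)%:R^-1 * Lim - #|kernel_reps g n.+1|%:R / #|T|%:R ^+ n.+1 * Lim -
  (c - #|kernel_reps g n.+1|%:R / #|T|%:R ^+ n.+1 * Lim) by ring.
by apply: le_lt_trans (ler_normB _ _) _; lra.
Qed.
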